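(* We have the equality $\Sigma \cap \mathbb{D} = \Sigma_{\pm 1} \cap \mathbb{D}$.
   Context: $\mathbb{D} := \{z \in \mathbb{C} : |z|<1\}$. For $c \in [-2,1/4]$ let $f_c(z) := z^2 + c$. The growth rate of $f_c$ is $s(f_c) := e^{h(f_c)}$, where $h(f_c)$ is the topological entropy of $f_c$ as a real interval map (i.e. restricted to its compact invariant interval $[-\beta,\beta]$, $\beta = (1+\sqrt{1-4c})/2$). The map $f_c$ is called superattracting if the critical point $0$ is periodic under $f_c$; $M_0$ denotes the set of superattracting parameters. For an algebraic number $\lambda$, $Gal(\lambda) \subset \mathbb{C}$ denotes the set of roots of its minimal polynomial. The entropy spectrum is $$\Sigma := \overline{\bigcup_{c \in M_0 \cap \mathbb{R}} Gal(s(f_c))} \subset \mathbb{C}.$$ The set $\Sigma_{\pm 1}$ is the set of zeros in $\mathbb{D}$ of power series with coefficients $\pm 1$: $$\Sigma_{\pm 1} := \Big\{ s \in \mathbb{D} : \sum_{k=0}^\infty \epsilon_k s^k = 0 \text{ for some sequence } (\epsilon_k)_{k\ge 0} \text{ with } \epsilon_k \in \{-1,+1\}\Big\}.$$ *)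

(* Defs.v *)
From HB Require Import structures.
From mathcomp Require Import all_boot all_order all_algebra finmap complex.
From mathcomp Require Import all_classical all_reals all_analysis.

Set Implicit Arguments.
Unset Strict Implicit.
Unset Printing Implicit Defensive.

Import Order.TTheory GRing.Theory Num.Theory numFieldNormedType.Exports.

Local Open Scope classical_set_scope.
Local Open Scope ring_scope.
Local Open Scope complex_scope.

(* The topological entropy of a self-map [f] of a compact [K] is taken in
   Bowen's form: lim_(e -> 0+) limsup_n (1/n) log S(n, e), where S(n, e) is the
   maximal cardinality of an (n, e)-separated subset of [K], i.e. of a set whose
   distinct points are at distance > e for the metric
   d_n(x, y) = max_(k < n) |f^k x - f^k y|. *)

Definition bowen_separated (R : realType) (f : R -> R) (K : set R) (n : nat) (e : R)
    (E : {fset R}) : Prop :=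
  [set` E] `<=` K /\
  {in E &, forall x y, x != y ->
    exists2 k, (k < n)%N & e < `|iter k f x - iter k f y|}.

Definition sep_number (R : realType) (f : R -> R) (K : set R) (n : nat) (e : R) :
    \bar R :=
  ereal_sup [set (#|` E|%:R)%:E | E in bowen_separated f K n e].

Definition topological_entropy (R : realType) (f : R -> R) (K : set R) : \bar R :=
  lim ((limn_esup (fun n : nat => ((n%:R^-1)%:E * lne (sep_number f K n e))%E))
         @[e --> (0 : R)^'+]).

Definition quad (R : realType) (c : R) : R -> R := fun x => x ^+ 2 + c.

Definition beta_fix (R : realType) (c : R) : R :=
  (1 + Num.sqrt (1 - 4 * c)) / 2.

Definition invariant_interval (R : realType) (c : R) : set R :=
  `[- beta_fix c, beta_fix c].

(* [fine] discards no information: the entropy of a unimodal map lies in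
   [0, log 2]. *)
Definition growth_rate (R : realType) (c : R) : R :=
  expR (fine (topological_entropy (quad c) (invariant_interval c))).

Definition superattracting (R : realType) : set R :=
  [set c | -2 <= c <= 1 / 4 /\
           exists2 n : nat, (0 < n)%N & iter n (quad c) 0 = 0].
Arguments superattracting : clear implicits.

Definition is_min_poly (R : realType) (p : {poly rat}) (z : R[i]) : Prop :=
  [/\ p \is monic, root (map_poly ratr p) z &
      forall q : {poly rat}, q != 0 -> root (map_poly ratr q) z ->
        (size p <= size q)%N].

(* Empty when [l] is transcendental. *)
Definition Gal (R : realType) (l : R[i]) : set R[i] :=
  [set z | exists2 p : {poly rat}, is_min_poly p l & root (map_poly ratr p) z].

(* The regular module [R[i]^o] carries the topology of the complex plane given
   by the modulus. *)
Definition Sigma (R : realType) : set R[i] :=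
  closure (\bigcup_(c in superattracting R) Gal (growth_rate c)%:C : set R[i]^o).
Arguments Sigma : clear implicits.

Definition unit_disk (R : realType) : set R[i] := [set z | `|z| < 1].
Arguments unit_disk : clear implicits.

Definition Sigma_pm1 (R : realType) : set R[i] :=
  [set s | unit_disk R s /\
    exists2 eps : nat -> R[i],
      (forall k, eps k = 1 \/ eps k = -1) &
      series (fun k => eps k * s ^+ k : R[i]^o) @ \oo --> (0 : R[i]^o)].
Arguments Sigma_pm1 : clear implicits.

(* Main.v *)
Require Import Defs.
From mathcomp Require Import all_boot all_order all_algebra finmap complex.
From mathcomp Require Import ring lra zify.
From mathcomp Require Import all_classical all_reals all_analysis.

(** Both inclusions rest on one fact of kneading theory. Let f = quad c have its
    critical point 0 periodic of period n, let sigma_j be the sign of f^j(0) and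
    eps_j = sigma_1 ... sigma_j. Then the growth rate s of f satisfies
    sum_(j < n) eps_j s^(n-1-j) = 0 (kneading_root).

    From left to right: a Galois conjugate z of s is also a root of this
    polynomial, whose coefficients are 1 and -1, and repeating the coefficients
    with period n produces a power series that vanishes at z when |z| < 1. Limits
    of such zeros are again such zeros since the space of sign sequences is
    compact (Sigma_disk_sub).

    From right to left: let z be a zero of sum_k e_k z^k. For h = 2^j take the
    polynomial Q of degree 2h - 1 with coefficients, from the lowest, e_0, ...,
    e_(h-3), tau, -1, ..., -1, 1. Read from the top, its coefficients form a
    kneading sequence that begins with a run too long to be beaten by anything
    that follows; such a sequence occurs for a parameter c by the intermediate
    value theorem (realization). The sign tau is chosen so that Q(1) is not
    divisible by 4; since Q is congruent to (x - 1)^(2h-1) modulo 2, Eisenstein's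
    criterion applies to Q(x + 1) and Q is irreducible (pm1_irreducible). Hence
    all its roots are conjugates of the growth rate of f. Finally Q(z) is
    exponentially small in h while the degree of Q is linear in h, and this
    forces a root of Q close to z (near_root): otherwise the first K Taylor
    coefficients of Q at z are negligible, so Q is nearly a multiple of
    (x - z)^K, and the inequality of Jensen makes |Q(0)| smaller than 1.

    The proof of kneading_root avoids Markov partitions. The operator pullback
    transports the distribution function of a measure on the line to that of its
    pull-back by f, branch by branch. Iterated on the sign function it counts the
    zeros of f^m (zcount), iterated on the identity it measures the variation of
    f^m (signed_variation). An (n, e)-separated set has at most 1 + V / e points,
    V being the sum of the variations of f^k for k < n; the variation of f^k is
    at most the length of the interval times laps k, a submultiplicative bound for
    the number of intervals of monotonicity of f^k; hence s^m <= laps m for every m (growth_rate_laps).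
    Conversely, 0 is isolated in the set of all its preimages because it is
    superattracting, so that the zeros of f^m form a separated set at a scale
    that does not depend on m, and their number grows at most like s^m
    (zcount_growth). Along the critical orbit the counting functions satisfy a
    recursion which, summed against t^m for t < 1/s, says that the kneading
    polynomial times a series with coefficients of constant sign is bounded.
    The partial sums of this series at 1/s are unbounded, by the lower bound on
    laps; so the kneading polynomial vanishes at 1/s. *)

Set Implicit Arguments.
Unset Strict Implicit.
Unset Printing Implicit Defensive.

Import Order.TTheory GRing.Theory Num.Theory numFieldNormedType.Exports.

Local Open Scope classical_set_scope.
Local Open Scope ring_scope.

(** * Pulling back measures by the quadratic map *)

(** If g is the distribution function of a measure mu, then pullback c g is, up to
    a constant, that of the measure which on each of the two half-lines is the
    image of mu under the inverse branch of quad c. The constant makes it odd. *)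
Definition pullback (R : realType) (c : R) (g : R -> R) : R -> R :=
  fun x => Num.sg x * (g (quad c x) - g c).

(** The sign function is the distribution function of twice the Dirac mass at 0,
    so that zcount c m is the one of twice the counting measure on the zeros of
    the m-th iterate (see zcountE); on an interval whose end points are zeros it
    gives these weight one half. *)
Definition zcount (R : realType) (c : R) (m : nat) : R -> R :=
  iter m (pullback c) Num.sg.

(** The total variation of the m-th iterate between 0 and x, with the sign of x. *)
Definition signed_variation (R : realType) (c : R) (m : nat) : R -> R :=
  iter m (pullback c) id.

(** The m-th iterate turns exactly at the zeros of the iterates of order k < m, and
    each summand is the number of zeros for one k; hence this bounds the number of
    intervals of monotonicity. A point that is a zero for several k is counted as
    many times, which makes lapsD and lapsS simple. *)
Definition laps (R : realType) (c : R) (m : nat) : R :=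
  1 + \sum_(k < m) zcount c k (beta_fix c).

Section Pullback.
Variables (R : realType) (c : R).
Implicit Types (g : R -> R) (x y u : R).

Lemma pullbackN g x : pullback c g (- x) = - pullback c g x.
Proof. by rewrite /pullback /quad sgrN sqrrN mulNr. Qed.

Lemma pullback0 g : pullback c g 0 = 0.
Proof. by rewrite /pullback sgr0 mul0r. Qed.

Lemma pullback_ge0E g x : 0 <= x -> pullback c g x = g (quad c x) - g c.
Proof.
rewrite le_eqVlt => /predU1P[<-|x0]; last by rewrite /pullback gtr0_sg ?mul1r.
by rewrite pullback0 /quad expr0n/= add0r subrr.
Qed.

Lemma le_quad x y : 0 <= x -> x <= y -> quad c x <= quad c y.
Proof.
by move=> x0 xy; rewrite /quad lerD2r ler_sqr ?nnegrE// (le_trans x0).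
Qed.

Lemma pullback_homo g : {homo g : x y / x <= y} ->
  {homo pullback c g : x y / x <= y}.
Proof.
move=> gh.
have pos x y : 0 <= x -> x <= y -> pullback c g x <= pullback c g y.
  move=> x0 xy; rewrite !pullback_ge0E ?(le_trans x0)// lerD2r.
  exact/gh/le_quad.
move=> x y xy; have [x0|/ltW x0] := leP 0 x; first exact: pos.
have [y0|/ltW y0] := leP 0 y; last first.
  by rewrite -lerN2 -pullbackN -[X in _ <= X]pullbackN pos ?lerN2 ?oppr_ge0.
apply: (@le_trans _ _ 0); last by rewrite -{1}(pullback0 g) pos.
by rewrite -oppr_ge0 -pullbackN -{1}(pullback0 g) pos ?oppr_ge0.
Qed.

Lemma iter_pullback_homo g m : {homo g : x y / x <= y} ->
  {homo iter m (pullback c) g : x y / x <= y}.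
Proof. by move=> gh; elim: m => //= m; apply: pullback_homo. Qed.

Lemma sgr_homo : {homo (@Num.sg R) : x y / x <= y}.
Proof.
move=> x y xy; case: (sgrP x) => hx; case: (sgrP y) => hy //; lra.
Qed.

Lemma zcount_homo m : {homo zcount c m : x y / x <= y}.
Proof. exact/iter_pullback_homo/sgr_homo. Qed.

Lemma zcountN m x : zcount c m (- x) = - zcount c m x.
Proof. by case: m => [|m]; rewrite /zcount/= ?sgrN// pullbackN. Qed.

Lemma zcount0 m : zcount c m 0 = 0.
Proof. by case: m => [|m]; rewrite /zcount/= ?sgr0// pullback0. Qed.

Lemma signed_variation_homo m : {homo signed_variation c m : x y / x <= y}.
Proof. by apply/iter_pullback_homo. Qed.

Lemma signed_variationN m x : signed_variation c m (- x) = - signed_variation c m x.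
Proof. by case: m => [|m] //; rewrite /signed_variation/= pullbackN. Qed.

Lemma signed_variation0 m : signed_variation c m 0 = 0.
Proof. by case: m => [|m] //; rewrite /signed_variation/= pullback0. Qed.

Lemma ler_dist_norm_homo g x y : {homo g : x y / x <= y} ->
  (forall x, g (- x) = - g x) -> g 0 = 0 ->
  `|g `|x| - g `|y| | <= `|g x - g y|.
Proof.
move=> gh gN g0.
have E z : g `|z| = `|g z|.
  have [z0|z0] := leP 0 z.
    by rewrite !ger0_norm// -g0 gh.
  by rewrite (ltr0_norm z0) gN ler0_norm// -g0 gh// ltW.
by rewrite !E ler_dist_dist.
Qed.

(** The pullbacks are odd and monotone, so that folding x and y to their absolute
    values does not increase the distance on the right, while the left-hand side
    depends on the absolute values only. *)
Lemma dist_iter_le_signed_variation m x y :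
  `|iter m (quad c) x - iter m (quad c) y| <=
  `|signed_variation c m x - signed_variation c m y|.
Proof.
elim: m x y => // m IH x y.
apply: (@le_trans _ _ `|signed_variation c m.+1 `|x| - signed_variation c m.+1 `|y| |).
  have E z : signed_variation c m.+1 `|z| = signed_variation c m (quad c z) - signed_variation c m c.
    rewrite -[LHS]/(pullback c (signed_variation c m) `|z|) pullback_ge0E//.
    by rewrite /quad real_normK ?num_real.
  by rewrite !E opprB addrA subrK !iterSr.
apply: ler_dist_norm_homo.
- exact: signed_variation_homo.
- by move=> z; exact: signed_variationN.
- exact: signed_variation0.
Qed.

(** Each zero of the iterate carries mass 2 for zcount, and at least half of it is
    seen from an interval that contains the zero, even as an end point. *)
Lemma zcount_jump m u x y : iter m (quad c) u = 0 -> x <= u <= y -> x < y ->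
  zcount c m x + 1 <= zcount c m y.
Proof.
elim: m u x y => [|m IH] u x y.
  rewrite /zcount/= => -> /andP[].
  by case: (sgrP x); case: (sgrP y); lra.
rewrite iterSr => fu.
have pos v x' y' : iter m (quad c) (quad c v) = 0 -> 0 <= x' -> x' <= v <= y' ->
    x' < y' -> zcount c m.+1 x' + 1 <= zcount c m.+1 y'.
  move=> fv x0 /andP[xv vy] xy; rewrite /zcount/= !pullback_ge0E; [|lra..].
  rewrite addrAC lerD2r; apply: (IH (quad c v)) => //.
    by rewrite !le_quad//; lra.
  rewrite /quad ltrD2r ltr_sqr ?nnegrE//; lra.
move=> /andP[xu uy] xy.
have fNu : iter m (quad c) (quad c (- u)) = 0 by rewrite /quad sqrrN.
have [x0|x0] := leP 0 x; first by apply: (pos u) => //; rewrite xu.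
have [y0|y0] := leP y 0.
  suff : zcount c m.+1 (- y) + 1 <= zcount c m.+1 (- x) by rewrite !zcountN; lra.
  by apply: (pos (- u)) => //; lra.
have [u0|u0] := leP 0 u.
  have := zcount_homo m.+1 (ltW x0); rewrite zcount0.
  have := @pos u 0 y fu; rewrite zcount0 lexx u0 uy y0 => /(_ isT isT isT); lra.
have := zcount_homo m.+1 (ltW y0); rewrite zcount0.
have := @pos (- u) 0 (- x) fNu; rewrite zcount0 lexx zcountN oppr_ge0 lerN2.
rewrite xu (ltW u0) oppr_gt0 x0 => /(_ isT isT isT); lra.
Qed.

Hypothesis c_itv : -2 <= c <= 1 / 4.
Let b := beta_fix c.

Lemma beta_fix_eq : quad c b = b.
Proof.
rewrite /quad /b /beta_fix.
have s0 : 0 <= 1 - 4 * c by move: c_itv; lra.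
have /(_ _ s0) := @sqr_sqrtr R; set s := Num.sqrt _ => ss.
by field: ss.
Qed.

Lemma beta_fix_ge : 1/2 <= b.
Proof.
rewrite /b /beta_fix; have := sqrtr_ge0 (1 - 4 * c); lra.
Qed.

Lemma beta_fixNle : - b <= c.
Proof.
have := beta_fix_eq; have := beta_fix_ge; rewrite /quad.
by move: c_itv => /andP[? ?]; nra.
Qed.

Lemma quad_beta x : - b <= x <= b -> c <= quad c x <= b.
Proof.
have := beta_fix_eq; have := beta_fix_ge; rewrite /quad => ? ? /andP[? ?].
apply/andP; split; nra.
Qed.

(** The iterate of order m maps each of its laps injectively, hence pulls back to it
    no more than the total mass of g. Folding at 0 gives an induction in which laps
    need not be mentioned: an interval around 0 is cut into two, and the additional
    summand 1 is accounted for by the term k = 0, where zcount jumps by 2. *)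
Lemma iter_pullback_mass g m x y : {homo g : x y / x <= y} ->
  - b <= x -> x <= y -> y <= b ->
  iter m (pullback c) g y - iter m (pullback c) g x <=
  (g b - g (- b)) * (1 + 2^-1 * \sum_(k < m) (zcount c k y - zcount c k x)).
Proof.
move=> gh; have cb := beta_fixNle; have b0 := beta_fix_ge.
have G0 : 0 <= g b - g (- b) by rewrite subr_ge0 gh//; lra.
elim: m x y => [|m IH] x y bx xy yb.
  rewrite big_ord0/= mulr0 addr0 mulr1.
  by have := gh _ _ bx; have := gh _ _ yb; lra.
have pos x' y' : 0 <= x' -> x' <= y' -> y' <= b ->
    iter m.+1 (pullback c) g y' - iter m.+1 (pullback c) g x' <=
    (g b - g (- b)) * (1 + 2^-1 * \sum_(k < m) (zcount c k.+1 y' - zcount c k.+1 x')).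
  move=> x0 xy' yb'.
  have /andP[cx _] : c <= quad c x' <= b by apply: quad_beta; lra.
  have /andP[_ yb''] : c <= quad c y' <= b by apply: quad_beta; lra.
  rewrite /= !pullback_ge0E; [|lra..].
  rewrite opprB addrA subrK; apply: le_trans (IH _ _ _ _ _) _ => //.
  - exact: (le_trans cb).
  - exact: le_quad.
  apply: ler_wpM2l => //; rewrite lerD2l ler_wpM2l//.
  apply: ler_sum => k _; rewrite /zcount/= !pullback_ge0E; lra.
have sumN z : \sum_(k < m) zcount c k.+1 (- z) = - \sum_(k < m) zcount c k.+1 z.
  by rewrite -sumrN; apply: eq_bigr => k _; rewrite zcountN.
have iterN z : iter m.+1 (pullback c) g (- z) = - iter m.+1 (pullback c) g z.
  by rewrite /= pullbackN.
have iter0 : iter m.+1 (pullback c) g 0 = 0 by rewrite /= pullback0.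
have sum0 : \sum_(k < m) zcount c k.+1 0 = 0.
  by rewrite big1// => k _; rewrite zcount0.
rewrite big_ord_recl sumrB; set A := bump 0.
rewrite (_ : \sum_(i < m) _ = \sum_(k < m) zcount c k.+1 y)//.
rewrite (_ : \sum_(i < m) zcount c (A i) x = \sum_(k < m) zcount c k.+1 x)//.
have D0 : 0 <= zcount c 0 y - zcount c 0 x by rewrite subr_ge0 zcount_homo.
have [x0|x0] := leP 0 x.
  apply: le_trans (pos _ _ x0 xy yb) _.
  rewrite sumrB; apply: ler_wpM2l => //; rewrite lerD2l ler_wpM2l//; lra.
have [y0|y0] := leP y 0.
  have := pos (- y) (- x); rewrite !iterN sumrB !sumN => P.
  have {P} : - iter m.+1 (pullback c) g x - - iter m.+1 (pullback c) g y <=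
     (g b - g (- b)) * (1 + 2^-1 *
     (- (\sum_(k < m) zcount c k.+1 x) - - (\sum_(k < m) zcount c k.+1 y))).
    by apply: P; lra.
  rewrite opprK addrC => P; apply: le_trans P _.
  apply: ler_wpM2l => //; rewrite lerD2l ler_wpM2l//; lra.
have := pos 0 y; rewrite iter0 sumrB sum0 !subr0 => /(_ (lexx _) (ltW y0) yb) P1.
have := pos 0 (- x); rewrite iter0 sumrB sum0 iterN sumN !subr0 => P2.
have {}P2 := P2 (lexx _) ltac:(lra) ltac:(lra).
have -> : zcount c 0 y = 1 by rewrite /zcount/= gtr0_sg.
have -> : zcount c 0 x = -1 by rewrite /zcount/= ltr0_sg.
apply: le_trans (lerD P1 P2) _.
rewrite -mulrDr; apply: ler_wpM2l => //.
move: (\sum_(k < m) _) (\sum_(k < m) _) => S1 S2; clear; lra.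
Qed.

Lemma iter_pullback_laps g m : {homo g : x y / x <= y} ->
  iter m (pullback c) g b - iter m (pullback c) g (- b) <= (g b - g (- b)) * laps c m.
Proof.
move=> gh; have b0 := beta_fix_ge.
apply: le_trans (iter_pullback_mass m gh _ _ _) _ => //; try lra.
apply: ler_wpM2l; first by rewrite subr_ge0 gh//; lra.
rewrite lerD2l mulr_sumr; apply: ler_sum => k _.
rewrite zcountN /b; lra.
Qed.

(** Take for g the counting function of the zeros of the k-th iterate. *)
Lemma zcountD_le m k : zcount c (m + k) b <= laps c m * zcount c k b.
Proof.
have := iter_pullback_laps m (@zcount_homo k).
rewrite -[X in X - _](_ : zcount c (m + k) b = _); last by rewrite /zcount iterD.
rewrite -[X in _ - X](_ : zcount c (m + k) (- b) = _); last by rewrite /zcount iterD.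
rewrite !zcountN; lra.
Qed.

Lemma zcountS_beta m : zcount c m.+1 b = zcount c m b - zcount c m c.
Proof.
by have := beta_fix_ge => ?; rewrite /zcount/= pullback_ge0E ?beta_fix_eq//; lra.
Qed.

Lemma zcount_c_le0 m : c <= 0 -> zcount c m c <= 0.
Proof. by move=> c0; rewrite -(zcount0 m) zcount_homo. Qed.

Lemma lapsD m k : laps c (m + k) <= laps c m * laps c k.
Proof.
rewrite /laps big_split_ord/= addrA mulrDr mulr1 lerD2l mulr_sumr.
by apply: ler_sum => i _; exact: zcountD_le.
Qed.

Lemma lapsS m : laps c m.+1 = laps c m + zcount c m b.
Proof. by rewrite /laps big_ord_recr addrA. Qed.

Lemma signed_variation_beta m : signed_variation c m b <= b * laps c m.
Proof.
have := @iter_pullback_laps id m (fun x y h => h).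
rewrite -/(signed_variation c m) signed_variationN; lra.
Qed.

End Pullback.

(** * Separated sets of the quadratic map *)

(** The real solutions of u ^+ 2 + c = v. *)
Definition fiber (R : realType) (c v : R) : seq R :=
  if c < v then [:: - Num.sqrt (v - c); Num.sqrt (v - c)]
  else if v == c then [:: 0] else [::].

Fixpoint preimages (R : realType) (c : R) (m : nat) : seq R :=
  if m is m'.+1 then flatten [seq fiber c v | v <- preimages c m'] else [:: 0].

Section Preimages.
Variables (R : realType) (c : R).
Implicit Types (u v x y e : R).

Lemma mem_fiber v u : (u \in fiber c v) = (quad c u == v).
Proof.
rewrite /fiber /quad.
have -> : (u ^+ 2 + c == v) = (u ^+ 2 == v - c).
  by rewrite -[in RHS](inj_eq (addIr c)) subrK.
case: ltgtP => [cv|cv|->].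
- rewrite -[in RHS](@sqr_sqrtr _ (v - c)) ?subr_ge0 ?ltW// eqf_sqr !inE orbC.
  by [].
- rewrite in_nil; apply/esym/negbTE; have := sqr_ge0 u.
  by apply: contraTneq => ->; rewrite subr_ge0 -ltNge.
- by rewrite subrr sqrf_eq0 mem_seq1.
Qed.

Lemma fiber_uniq v : uniq (fiber c v).
Proof.
rewrite /fiber; case: ltgtP => // cv.
by rewrite /= inE andbT -subr_eq0 -opprD oppr_eq0 -mulr2n mulrn_eq0/= sqrtr_eq0
  -ltNge subr_gt0.
Qed.

Lemma mem_preimages m u : (u \in preimages c m) = (iter m (quad c) u == 0).
Proof.
elim: m u => [|m IH] u; first by rewrite inE.
rewrite iterSr -IH /=; apply/flatten_mapP/idP => [[v vm]|um].
  by rewrite mem_fiber => /eqP ->.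
by exists (quad c u) => //; rewrite mem_fiber.
Qed.

Lemma preimages_uniq m : uniq (preimages c m).
Proof.
elim: m => //= m; elim: preimages => //= v s IH /andP[vs us].
rewrite cat_uniq fiber_uniq IH// andbT; apply/hasPn => u /flatten_mapP[w ws].
rewrite !mem_fiber => /eqP ->; by apply: contraNneq vs => <-.
Qed.

(** This identity makes the sum over preimages obey the recursion that defines
    pullback, including at the points where a sign vanishes. *)
Lemma sum_sgr_fiber v x :
  \sum_(u <- fiber c v) Num.sg (x - u) =
  Num.sg x * (Num.sg (quad c x - v) - Num.sg (c - v)).
Proof.
rewrite /fiber; case: ltgtP => cv.
- rewrite !big_cons big_nil addr0 opprK.
  have cv0 : 0 < v - c by rewrite subr_gt0.
  have w0 : 0 < Num.sqrt (v - c) by rewrite sqrtr_gt0.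
  rewrite (ltr0_sg (x := c - v)) ?subr_lt0//.
  rewrite (_ : quad c x - v = (x + Num.sqrt (v - c)) * (x - Num.sqrt (v - c))); last first.
    by rewrite [RHS]mulrC -subr_sqr sqr_sqrtr ?ltW// /quad; ring.
  rewrite sgrM; move: (Num.sqrt _) w0 => w w0; clear -w0.
  case: (sgrP x) => ?; case: (sgrP (x + w)) => ?; case: (sgrP (x - w)) => ? //; lra.
- rewrite big_nil (gtr0_sg (x := c - v)) ?subr_gt0//.
  rewrite (gtr0_sg (x := quad c x - v)) ?subrr ?mulr0//.
  by rewrite subr_gt0 /quad (lt_le_trans cv)// lerDr sqr_ge0.
- rewrite cv big_seq1 subr0 subrr sgr0 subr0 /quad addrK.
  by rewrite sgrX; case: (sgrP x) => _; rewrite ?mul0r// ?expr1n ?sqrrN ?expr1n mulr1.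
Qed.

Lemma zcountE m x : zcount c m x = \sum_(u <- preimages c m) Num.sg (x - u).
Proof.
elim: m x => [|m IH] x; first by rewrite big_seq1 subr0.
rewrite [RHS]big_flatten/= big_map.
rewrite -[LHS]/(Num.sg x * (zcount c m (quad c x) - zcount c m c)).
rewrite !IH -sumrB mulr_sumr; apply: eq_bigr => v _; by rewrite sum_sgr_fiber.
Qed.

Lemma zcount_le_size m x : zcount c m x <= (size (preimages c m))%:R.
Proof.
rewrite zcountE -sum1_size natr_sum; apply: ler_sum => u _.
by case: sgrP => _; lra.
Qed.

Lemma iter_quad_poly (j : nat) : exists2 p : {poly R}, p != 0 &
  forall u, p.[u] = iter j (quad c) u.
Proof.
suff [p pE] : exists p : {poly R}, forall u, p.[u] = iter j (quad c) u.
  exists p => //; have [k M] : exists k : R, 0 < k /\ forall u, k <= u -> k <= quad c u.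
    exists (1 + `|c|); split; first by rewrite ltr_wpDr.
    move=> u; rewrite /quad; have := ler_norm (- c); rewrite normrN.
    have := normr_ge0 c; move: `|c| => k ? ? ?; nra.
  case: M => k0 M; apply/eqP => p0.
  suff : k <= p.[k] by rewrite p0 horner0; lra.
  by rewrite pE; elim: j {p p0 pE} => //= j IH; exact: M.
elim: j => [|j [p pE]]; first by exists 'X => u; rewrite hornerX.
by exists (p ^+ 2 + c%:P) => u; rewrite !hornerE pE.
Qed.

(** Divide out the power of 'X: the remaining factor is continuous and does not
    vanish at 0. *)
Lemma poly_nonroot_near0 (p : {poly R}) : p != 0 ->
  \forall u \near (0 : R), u != 0 -> p.[u] != 0.
Proof.
move=> p0; have [k [q]] := multiplicity_XsubC p 0.
rewrite p0/= => q0 ->; rewrite subr0.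
have qc : horner q u @[u --> 0] --> q.[0] by exact: continuous_horner.
apply: filterS (cvgr_neq0 _ qc q0) => u qu u0.
by rewrite !hornerE mulf_neq0// expf_neq0.
Qed.

Lemma near0_ball (P : R -> Prop) : (\forall u \near (0 : R), P u) ->
  exists2 e : R, 0 < e & forall u, `|u| < e -> P u.
Proof.
move=> /nbhs_ballP[e /= e0 eP]; exists e => // u ue; apply: eP.
by rewrite /ball/= sub0r normrN.
Qed.

(** The n-th iterate fixes 0 with derivative 0, hence maps a small punctured
    neighbourhood of 0 into itself; since the first n iterates have finitely many
    zeros, none of them vanishes there after shrinking, and the orbit of a point
    of this neighbourhood never hits 0. *)
Lemma critical_basin n : (0 < n)%N -> iter n (quad c) 0 = 0 ->
  exists2 e, 0 < e & forall u j, 0 < `|u| < e -> iter j (quad c) u != 0.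
Proof.
case: n => // n _ fn0.
have [p _ pE] := iter_quad_poly n.
have /factor_theorem[q pq] : root p c.
  have c0 : quad c 0 = c by rewrite /quad expr0n add0r.
  by rewrite /root pE -{2}c0 -iterSr fn0.
have fE u : iter n.+1 (quad c) u = q.[u ^+ 2 + c] * u * u.
  by rewrite iterSr -pE pq hornerM hornerXsubC /quad addrK expr2 mulrA.
(* By fE the iterate is u times a polynomial that vanishes at 0. *)
have contr : \forall u \near (0 : R), `|iter n.+1 (quad c) u| <= `|u|.
  have : ((q \Po ('X^2 + c%:P)) * 'X).[u] @[u --> (0 : R)] --> (0 : R).
    rewrite -[X in _ --> X](_ : ((q \Po ('X^2 + c%:P)) * 'X).[0] = 0).
      exact: continuous_horner.
    by rewrite hornerM hornerX mulr0.
  move=> /cvgr0_norm_le/(_ 1 ltr01); apply: filterS => u.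
  rewrite hornerM hornerX horner_comp !hornerE => h.
  by rewrite fE normrM ler_piMl.
have nz : \forall u \near (0 : R), forall j : 'I_n.+2, u != 0 -> iter j (quad c) u != 0.
  apply: (@filter_forall R _ (fun (j : 'I_n.+2) u => u != 0 ->
    iter j (quad c) u != 0) (nbhs (0 : R))) => j.
  have [p' p0 p'E] := iter_quad_poly j.
  by apply: filterS (poly_nonroot_near0 p0) => u; rewrite p'E.
have [e e0 eP] := near0_ball (filterI contr nz).
exists e => // u j; elim/ltn_ind: j u => j IH u /andP[u0 ue].
have [jn|nj] := ltnP j n.+2.
  by have [_ /(_ (Ordinal jn))] := eP _ ue; apply; rewrite -normr_gt0.
rewrite -(subnK (ltnW nj)) iterD; apply: IH.
  by lia.
have u_neq0 : u != 0 by rewrite -normr_gt0.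
have [le_u /(_ ord_max u_neq0) w0] := eP _ ue.
by rewrite normr_gt0 w0/=; exact: le_lt_trans le_u ue.
Qed.

(** At the last time before the orbits of x and y merge they are opposite, at u and
    -u, and u is a zero of a later iterate, hence is not in the basin of 0. *)
Lemma preimages_separated e m x y :
  (forall u j, 0 < `|u| < e -> iter j (quad c) u != 0) ->
  iter m (quad c) x = 0 -> iter m (quad c) y = 0 -> x != y ->
  exists2 k, (k < m.+1)%N & 2 * e <= `|iter k (quad c) x - iter k (quad c) y|.
Proof.
move=> eP; elim: m x y => [|m IH] x y; first by move=> /= -> ->; rewrite eqxx.
move=> fx fy xy; have [fxy|fxy] := eqVneq (quad c x) (quad c y); last first.
  have [||k km ek] := IH _ _ _ _ fxy; rewrite -?iterSr//.
  by exists k.+1; rewrite ?iterSr.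
exists 0%N => //=; move/addIr/eqP: fxy; rewrite eqf_sqr (negbTE xy)/= => /eqP xNy.
have x0 : x != 0.
  apply: contra_neq xy => x0; rewrite x0.
  by apply/eqP; rewrite -[y]opprK -xNy x0 oppr0.
rewrite -[y]opprK -xNy opprK -mulr2n normrMn mulr2n.
suff : e <= `|x| by lra.
rewrite leNgt; apply/negP => xe.
by have := eP x m.+1; rewrite normr_gt0 x0 xe fx eqxx => /(_ isT).
Qed.

End Preimages.

Section SepNumber.
Variables (R : realType) (c : R).
Hypothesis c_itv : -2 <= c <= 1 / 4.
Let b := beta_fix c.
Local Notation sep := (sep_number (quad c) (invariant_interval c)).

Lemma preimages_beta m u : u \in preimages c m -> - b <= u <= b.
Proof.
have b0 := beta_fix_ge c; have bE := beta_fix_eq c_itv.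
elim: m u => [|m IH] u; first by rewrite inE => /eqP ->; rewrite /b; lra.
rewrite mem_preimages iterSr -mem_preimages => /IH/andP[_].
rewrite -/b in b0 bE.
move: bE; rewrite /quad => bE ub.
rewrite -ler_norml -ler_sqr ?nnegrE ?normr_ge0//; last lra.
by rewrite real_normK ?num_real//; lra.
Qed.

Lemma zcount_le_sep n : (0 < n)%N -> iter n (quad c) 0 = 0 ->
  exists2 e, 0 < e & forall m, ((zcount c m b)%:E <= sep m.+1 e)%E.
Proof.
move=> n0 fn; have [e e0 eP] := critical_basin n0 fn.
exists e => // m; apply: le_trans (_ : ((size (preimages c m))%:R)%:E <= _)%E.
  by rewrite lee_fin zcount_le_size.
apply: ereal_sup_ubound; exists [fset x in preimages c m]%fset; last first.
  by rewrite card_fseq undup_id ?preimages_uniq.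
split=> [x /=|x y].
  by rewrite !inE => /preimages_beta; rewrite /invariant_interval/= in_itv.
rewrite !inE !mem_preimages => /eqP xm /eqP ym xy.
have [k km ek] := preimages_separated eP xm ym xy.
by exists k => //; apply: lt_le_trans ek; lra.
Qed.

(** Consecutive points are at distance > e at some time k < N, and the distances at
    time k add up to at most the variation of the k-th iterate. *)
Lemma separated_size N e (x : R) (s : seq R) :
  path <%R x s ->
  {in x :: s &, forall u v, u != v ->
    exists2 k, (k < N)%N & e < `|iter k (quad c) u - iter k (quad c) v|} ->
  e * (size s)%:R <= \sum_(k < N) (signed_variation c k (last x s) - signed_variation c k x).
Proof.
elim: s x => [|y s IH] x /=.
  by rewrite mulr0 sumr_ge0// => k _; rewrite subrr.
move=> /andP[xy ys] sP.
have {}IH := IH y ys (fun u v us vs => sP u v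
  ltac:(by rewrite inE us orbT) ltac:(by rewrite inE vs orbT)).
have [k kN ek] : exists2 k, (k < N)%N & e < `|iter k (quad c) y - iter k (quad c) x|.
  by apply: sP; rewrite ?inE ?eqxx ?orbT// gt_eqF.
rewrite -natr1 mulrDr mulr1.
have E1 : e <= \sum_(k < N) (signed_variation c k y - signed_variation c k x).
  rewrite (bigD1 (Ordinal kN))//=; apply: le_trans (ltW ek) _.
  rewrite -[leLHS]addr0; apply: lerD.
    apply: le_trans (dist_iter_le_signed_variation _ _ _ _) _.
    by rewrite ger0_norm// subr_ge0 signed_variation_homo// ltW.
  by apply: sumr_ge0 => i _; rewrite subr_ge0 signed_variation_homo// ltW.
apply: le_trans (lerD IH E1) _.
by rewrite -big_split/=; apply: ler_sum => i _; rewrite addrA subrK.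
Qed.

Lemma zcount_beta_ge0 m : 0 <= zcount c m b.
Proof.
by rewrite -(zcount0 c m) zcount_homo//; have := beta_fix_ge c; rewrite /b; lra.
Qed.

Lemma laps_homo : {homo laps c : m n / (m <= n)%N >-> m <= n}.
Proof.
by apply: homo_leq => //; [exact: le_trans|move=> m; rewrite lapsS lerDl zcount_beta_ge0].
Qed.

Lemma sep_le_laps N e : 0 < e ->
  (sep N e <= (1 + e^-1 * (2 * b * N%:R * laps c N))%:E)%E.
Proof.
move=> e0; apply: ge_ereal_sup => _ [E [EK Esep] <-]; rewrite lee_fin.
have b0 : 0 <= b by have := beta_fix_ge c; rewrite /b; lra.
have M0 : 0 <= 2 * b * N%:R * laps c N.
  by rewrite !mulr_ge0// addr_ge0// sumr_ge0// => k _; exact: zcount_beta_ge0.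
have := sort_lt_sorted E; rewrite fset_uniq.
have mE u : (u \in sort <=%R E) = (u \in E) by rewrite mem_sort.
rewrite -(size_sort <=%R E); move: (sort _ _) mE => s mE.
case: s mE => [|x s] mE sP.
  by rewrite addr_ge0// mulr_ge0// invr_ge0 ltW.
rewrite /= -natr1 addrC lerD2l mulrC ler_pdivlMr// mulrC.
apply: le_trans (separated_size (N := N) sP _) _.
  by move=> u v; rewrite !mE; exact: Esep.
apply: (@le_trans _ _ (\sum_(k < N) 2 * b * laps c N)); last first.
  by rewrite sumr_const card_ord -[leLHS]mulr_natr mulrAC.
apply: ler_sum => k _.
have xsb u : u \in x :: s -> - b <= u <= b.
  by rewrite mE => /EK; rewrite /invariant_interval/= in_itv.
have /andP[_ lb] := xsb _ (mem_last x s).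
have /andP[xb _] := xsb _ (mem_head x s).
have := signed_variation_beta c_itv k; have := signed_variation_homo c k lb.
have := signed_variation_homo c k xb; rewrite signed_variationN -/b.
have : b * laps c k <= b * laps c N by rewrite ler_wpM2l// laps_homo// ltnW.
by rewrite mulrC mulrA mulrAC; lra.
Qed.

Lemma lapsX m k : laps c (m * k) <= laps c m ^+ k.
Proof.
elim: k => [|k IH]; first by rewrite muln0 /laps big_ord0 addr0.
rewrite mulnS exprS; apply: le_trans (lapsD c_itv _ _) _.
by apply: ler_wpM2l IH; rewrite addr_ge0// sumr_ge0// => i _; exact: zcount_beta_ge0.
Qed.

(** The left-hand side is at most 1 + q + ... + q ^+ n.-1. *)
Lemma mulrn_exp_le (q : R) n : 0 <= q < 1 -> n%:R * q ^+ n <= (1 - q)^-1.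
Proof.
move=> /andP[q0 q1]; rewrite -div1r ler_pdivlMr ?subr_gt0//.
suff : n%:R * q ^+ n * (1 - q) <= 1 - q ^+ n by have := exprn_ge0 n q0; lra.
elim: n => [|n IH]; first by rewrite !mul0r expr0 subrr.
have qn := exprn_ge0 n q0; move: IH; rewrite exprS -natr1.
have t1 : q ^+ n <= 1 by rewrite exprn_ile1// ltW.
have := ler0n R n; move: (q ^+ n) (n%:R) qn t1 => t k t0 t1 k0 IH.
have h1 : k * t * (1 - q) * q <= (1 - t) * q by rewrite ler_wpM2r.
have h2 : q * t <= 1 by rewrite mulr_ile1 // ltW.
have h3 : 0 <= (1 - q) * (1 - q * t) by rewrite mulr_ge0 ?subr_ge0// ltW.
clear -h1 h3; lra.
Qed.

(** Submultiplicativity spreads the bound for a single m to all N, the linear factor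
    N of sep_le_laps being absorbed by the geometric decay of the ratio of
    laps c m to x ^+ m. *)
Lemma laps_growth m (x : R) : (0 < m)%N -> 1 <= x -> laps c m < x ^+ m ->
  forall e, 0 < e -> exists2 C, 0 < C & forall N, (sep N e <= (C * x ^+ N)%:E)%E.
Proof.
move=> m0 x1 lx e e0.
have b0 : 0 <= b by have := beta_fix_ge c; rewrite /b; lra.
have l0 : 0 <= laps c m.
  by rewrite addr_ge0// sumr_ge0// => i _; exact: zcount_beta_ge0.
have x0 : 0 < x by lra.
have xm0 : 0 < x ^+ m by rewrite exprn_gt0.
set q := laps c m / x ^+ m.
have q01 : 0 <= q < 1 by rewrite divr_ge0 ?(ltW xm0)// ltr_pdivrMr// mul1r.
have iq : 0 < (1 - q)^-1 by rewrite invr_gt0; lra.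
set D := m%:R * (1 - q)^-1 * x ^+ m.
have D0 : 0 <= D by rewrite /D !mulr_ge0 ?(ltW iq) ?(ltW xm0).
have ND N : N%:R * laps c N <= D * x ^+ N.
  set a := (N %/ m)%N.
  have Na : (N <= m * a.+1)%N by rewrite mulnC ltnW// ltn_ceil.
  have maN : (m * a <= N)%N by rewrite mulnC leq_divM.
  apply: (@le_trans _ _ ((m * a.+1)%:R * laps c m ^+ a.+1)).
    apply: ler_pM; rewrite ?ler_nat//.
      by rewrite addr_ge0// sumr_ge0// => i _; exact: zcount_beta_ge0.
    exact: le_trans (laps_homo Na) (lapsX _ _).
  have -> : laps c m = q * x ^+ m by rewrite /q divfK ?gt_eqF.
  rewrite exprMn -exprM natrM.
  have h := mulrn_exp_le a.+1 q01.
  apply: (@le_trans _ _ (m%:R * (1 - q)^-1 * x ^+ (m * a.+1))).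
    rewrite [leLHS]mulrA; apply: ler_wpM2r; first by rewrite exprn_ge0 ?ltW.
    by rewrite -[leLHS]mulrA; apply: ler_wpM2l.
  rewrite /D -!mulrA ler_wpM2l// ler_wpM2l ?(ltW iq)// -exprD.
  by apply: ler_weXn2l; rewrite // mulnS leq_add2l.
have ie : 0 <= e^-1 by rewrite invr_ge0 ltW.
exists (1 + e^-1 * (2 * b * D)).
  by rewrite ltr_wpDr//; do 3 apply: mulr_ge0 => //.
move=> N; apply: le_trans (sep_le_laps _ e0) _; rewrite lee_fin [leRHS]mulrDl [1 * _]mul1r.
apply: lerD; first exact: exprn_ege1.
rewrite -[leRHS]mulrA; apply: ler_wpM2l => //.
rewrite -[leLHS]mulrA -[leRHS]mulrA; apply: ler_wpM2l; last exact: ND.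
exact: mulr_ge0.
Qed.

End SepNumber.

(** * Bounds on the entropy from separated sets *)

Section Entropy.
Variables (R : realType) (f : R -> R) (K : set R).
Local Notation sep := (sep_number f K).
Let H (e : R) : \bar R :=
  limn_esup (fun n : nat => ((n%:R^-1)%:E * lne (sep n e))%E).

Hypothesis K0 : K !=set0.

Lemma sep_number_ge1 n e : (1 <= sep n e)%E.
Proof.
have [x Kx] := K0; apply: ereal_sup_ubound; exists [fset x]%fset; last first.
  by rewrite cardfs1.
split=> [y /=|y z]; first by rewrite inE => /eqP ->.
by rewrite !inE => /eqP -> /eqP ->; rewrite eqxx.
Qed.

Lemma sep_number_anti n e1 e2 : e1 <= e2 -> (sep n e2 <= sep n e1)%E.
Proof.
move=> e12; apply: ereal_sup_le => _ [E [EK EP] <-]; exists E => //; split=> // x y xE yE xy.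
by have [k kn ek] := EP x y xE yE xy; exists k => //; exact: le_lt_trans ek.
Qed.

Lemma sep_lne n e : sep n e \in `[0, +oo%E].
Proof. by rewrite in_itv/= leey andbT (le_trans _ (sep_number_ge1 n e)). Qed.

Lemma separated_entropy_anti e1 e2 : e1 <= e2 -> (H e2 <= H e1)%E.
Proof.
move=> e12; apply: le_ereal_inf_tmp => _ [V Vo <-].
apply: le_trans (_ : (ereal_sup [set (n%:R^-1)%:E * lne (sep n e2) | n in V] <= _)%E).
  by apply: ereal_inf_lbound; exists V.
apply: ge_ereal_sup => _ [n Vn <-].
apply: (@le_trans _ _ ((n%:R^-1)%:E * lne (sep n e1))%E).
  apply: lee_wpmul2l; first by rewrite lee_fin invr_ge0.
  by rewrite lee_lne ?sep_lne// sep_number_anti.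
by apply: ereal_sup_ubound; exists n.
Qed.

(** The limit as e decreases to 0 is a supremum, because fewer sets are separated at
    a larger scale. *)
Lemma topological_entropyE :
  topological_entropy f K = ereal_sup [set H e | e in `]0, +oo[].
Proof.
apply/cvg_lim => //; apply: nonincreasing_at_right_cvge => //.
by move=> e1 e2 _ _; exact: separated_entropy_anti.
Qed.

Lemma topological_entropy_ge0 : (0 <= topological_entropy f K)%E.
Proof.
rewrite topological_entropyE; apply: le_trans (_ : H 1 <= _)%E.
  apply: limf_esup_ge0 => [|n].
    by case=> N _ /(_ N (leqnn N)).
  by rewrite mule_ge0 ?lee_fin ?invr_ge0// lne_ge0 sep_number_ge1.
by apply: ereal_sup_ubound; exists 1 => //; rewrite /= in_itv/= andbT.
Qed.

(** The constant C disappears after division by n. *)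
Lemma topological_entropy_le (x : R) : 1 <= x ->
  (forall e, 0 < e -> exists2 C, 0 < C & forall n, (sep n e <= (C * x ^+ n)%:E)%E) ->
  (topological_entropy f K <= (ln x)%:E)%E.
Proof.
move=> x1 sepP; rewrite topological_entropyE; apply: ge_ereal_sup => _ [e /= + <-].
rewrite in_itv/= andbT => /sepP[C C0 CP].
have x0 : 0 < x by lra.
apply/lee_addgt0Pr => d d0.
set N := Num.bound (`|ln C| / d).
apply: (@le_trans _ _ (ereal_sup [set (n%:R^-1)%:E * lne (sep n e) | n in
   [set n | (N.+1 <= n)%N]])%E).
  by apply: ereal_inf_lbound; exists [set n | (N.+1 <= n)%N] => //; exists N.+1.
apply: ge_ereal_sup => _ [n /= Nn <-].
have n0 : (0 < n)%N by exact: leq_trans Nn.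
have n0R : 0 < (n%:R : R) by rewrite ltr0n.
apply: (@le_trans _ _ ((n%:R^-1)%:E * (ln (C * x ^+ n))%:E)%E).
  apply: lee_wpmul2l; first by rewrite lee_fin invr_ge0.
  have Cx0 : 0 < C * x ^+ n by rewrite mulr_gt0// exprn_gt0.
  rewrite -lne_EFin// lee_lne ?sep_lne ?CP//.
  by rewrite in_itv/= leey lee_fin ltW.
rewrite -EFinM -EFinD lee_fin lnM ?posrE ?exprn_gt0// lnXn// mulrDr addrC.
rewrite -[ln x *+ n]mulr_natl mulKf ?gt_eqF// lerD2l.
rewrite mulrC ler_pdivrMr// mulrC -ler_pdivrMr//.
apply: (@le_trans _ _ (`|ln C| / d)); first by rewrite ler_pM2r ?invr_gt0 ?ler_norm.
apply: le_trans (ltW (archi_boundP _)) _; first by rewrite divr_ge0 ?(ltW d0).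
by rewrite ler_nat ltnW.
Qed.

Lemma topological_entropy_lt (x e : R) : 0 < e -> 0 < x ->
  (topological_entropy f K < (ln x)%:E)%E ->
  exists N, forall n, (N <= n)%N -> (sep n e <= (x ^+ n)%:E)%E.
Proof.
move=> e0 x0 hx.
have : (H e < (ln x)%:E)%E.
  apply: le_lt_trans hx; rewrite topological_entropyE.
  by apply: ereal_sup_ubound; exists e => //; rewrite /= in_itv/= andbT.
move=> /ereal_inf_lt[_ [V [N _ NV] <-] Vx].
exists N.+1 => n Nn.
have n0 : (0 < n)%N by exact: leq_trans Nn.
have n0R : 0 < (n%:R : R) by rewrite ltr0n.
have : ((n%:R^-1)%:E * lne (sep n e) <= (ln x)%:E)%E.
  apply: le_trans (ltW Vx); apply: ereal_sup_ubound; exists n => //.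
  by apply: NV => /=; exact: ltnW.
rewrite lee_pdivrMl// => h.
rewrite -lee_lne ?sep_lne//; last by rewrite in_itv/= leey lee_fin exprn_ge0 ?ltW.
by rewrite lne_EFin ?exprn_gt0// lnXn// -mulr_natl EFinM.
Qed.

End Entropy.

(** * The growth rate and the number of laps *)

Section Growth.
Variables (R : realType) (c : R).
Hypothesis c_itv : -2 <= c <= 1 / 4.
Let b := beta_fix c.
Let s := growth_rate c.
Let K0 : invariant_interval c !=set0.
Proof.
exists 0; rewrite /invariant_interval/= in_itv/=.
by have := beta_fix_ge c; lra.
Qed.

Lemma laps_ge1 m : 1 <= laps c m.
Proof. by rewrite lerDl sumr_ge0// => k _; exact: zcount_beta_ge0. Qed.

Lemma zcount0_beta : zcount c 0 b = 1.
Proof. by rewrite /zcount/= gtr0_sg//; have := beta_fix_ge c; rewrite /b; lra. Qed.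

Lemma entropy_le_ln m (x : R) : (0 < m)%N -> 1 <= x -> laps c m < x ^+ m ->
  (topological_entropy (quad c) (invariant_interval c) <= (ln x)%:E)%E.
Proof.
move=> m0 x1 lx; apply: topological_entropy_le => // e e0.
exact: (laps_growth c_itv m0 x1 lx e0).
Qed.

(** Three is larger than the two laps of quad c, so the entropy is finite and fine
    loses nothing. *)
Lemma entropy_growth_rate :
  topological_entropy (quad c) (invariant_interval c) = (ln s)%:E.
Proof.
have l1 : laps c 1 < 3 ^+ 1.
  by rewrite /laps big_ord1 zcount0_beta expr1; lra.
have l3 : 1 <= 3 :> R by rewrite ler1n.
have := entropy_le_ln (ltn0Sn 0) l3 l1.
have := @topological_entropy_ge0 R (quad c) _ K0.
rewrite /s /growth_rate expRK; case: topological_entropy => //.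
Qed.

Lemma growth_rate_ge1 : 1 <= s.
Proof.
rewrite /s /growth_rate -expR0 ler_expR fine_ge0//.
exact: topological_entropy_ge0.
Qed.

Lemma growth_rate_le (x : R) : 0 < x ->
  (topological_entropy (quad c) (invariant_interval c) <= (ln x)%:E)%E -> s <= x.
Proof.
have s0 : 0 < s by rewrite /s /growth_rate expR_gt0.
by move=> x0; rewrite entropy_growth_rate lee_fin ler_ln.
Qed.

(** Apply entropy_le_ln to every x above the m-th root of laps c m. *)
Lemma growth_rate_laps m : s ^+ m <= laps c m.
Proof.
case: m => [|m]; first by rewrite expr0 laps_ge1.
set x0 := laps c m.+1 `^ (m.+1%:R^-1).
have l1 := laps_ge1 m.+1.
have x0m : x0 ^+ m.+1 = laps c m.+1.
  by rewrite -powR_mulrn ?powR_ge0// -powRrM mulVf ?pnatr_eq0// powRr1// (le_trans _ l1).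
have x01 : 1 <= x0 by rewrite -(@expr_ge1 _ m.+1) ?powR_ge0// x0m.
rewrite -x0m; apply: lerXn2r; rewrite ?nnegrE ?(le_trans _ growth_rate_ge1)//.
  by rewrite (le_trans _ x01).
apply/ler_addgt0Pr => d d0; apply: growth_rate_le; first by lra.
apply: (@entropy_le_ln m.+1) => //; first by lra.
by rewrite -x0m ltrXn2r//; lra.
Qed.

Lemma zcount_growth n (x : R) : (0 < n)%N -> iter n (quad c) 0 = 0 -> s < x ->
  exists N, forall m, (N <= m)%N -> zcount c m b <= x ^+ m.+1.
Proof.
move=> n0 fn sx; have [e e0 eP] := zcount_le_sep c_itv n0 fn.
have s0 : 0 < s by rewrite /s /growth_rate expR_gt0.
have x0 : 0 < x by rewrite (lt_trans s0).
have [] := @topological_entropy_lt R (quad c) _ K0 x e e0 x0.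
  by rewrite entropy_growth_rate lte_fin ltr_ln.
move=> N NP; exists N => m Nm; rewrite -lee_fin.
apply: le_trans (eP m) _; apply: NP; exact: leq_trans Nm _.
Qed.

End Growth.

(** * The growth rate is a root of the kneading polynomial *)

Section Kneading.
Variables (R : realType) (c : R) (n : nat) (sigma : nat -> R).
Hypothesis c_itv : -2 <= c <= 1 / 4.
Hypothesis c_lt0 : c < 0.
Hypothesis n_gt0 : (0 < n)%N.
Hypothesis fn0 : iter n (quad c) 0 = 0.
Hypothesis sigma_pm1 : forall j, (0 < j < n)%N -> sigma j = 1 \/ sigma j = -1.
Hypothesis sigma_sign : forall j, (0 < j < n)%N -> 0 <= sigma j * iter j (quad c) 0.
Let b := beta_fix c.
Let s := growth_rate c.
Let x_ j := iter j (quad c) 0.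

Definition itinerary_sign (j : nat) : R := \prod_(i < j) sigma i.+1.

(** The kneading determinant of the periodic critical point, without its periodic
    factor. *)
Definition kneading_poly : {poly R} := \poly_(j < n) itinerary_sign j.

Lemma itinerary_sign_norm j : (j < n)%N -> `|itinerary_sign j| = 1.
Proof.
move=> jn; rewrite normr_prod big1// => i _.
by have [->|->] := @sigma_pm1 i.+1 (leq_ltn_trans (ltn_ord i) jn);
  rewrite ?normrN normr1.
Qed.

Lemma orbit1 : x_ 1 = c.
Proof. by rewrite /x_/= /quad expr0n add0r. Qed.

(** Where the orbit passes through 0 before time n both sides vanish, since the next
    point of the orbit is c. *)
Lemma zcount_orbit m j : (0 < j < n)%N ->
  zcount c m.+1 (x_ j) = sigma j * (zcount c m (x_ j.+1) - zcount c m c).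
Proof.
move=> jn; rewrite -[LHS]/(Num.sg (x_ j) * (zcount c m (x_ j.+1) - zcount c m c)).
have := sigma_sign jn; rewrite -/(x_ j); case: (sgrP (x_ j)) => [x0 _|x0|x0].
- suff -> : x_ j.+1 = c by rewrite subrr !mulr0.
  by rewrite /x_ iterS -/(x_ j) x0 /quad expr0n add0r.
- by case: (sigma_pm1 jn) => -> //; rewrite mulN1r; lra.
- by case: (sigma_pm1 jn) => -> //; rewrite mul1r; lra.
Qed.

Lemma orbit_beta j : - b <= x_ j <= b.
Proof.
have b0 := beta_fix_ge c; elim: j => [|j IH]; first by rewrite /x_/= /b; lra.
by have := quad_beta c_itv IH; have := beta_fixNle c_itv; rewrite /b /x_/=; lra.
Qed.

Lemma zcount_orbit_le m j : `|zcount c m (x_ j)| <= zcount c m b.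
Proof.
have /andP[bx xb] := orbit_beta j.
by rewrite ler_norml -zcountN !zcount_homo.
Qed.

Let orbit_sum N j (t : R) := \sum_(m < N) zcount c m (x_ j) * t ^+ m.

(** Sum the recursion zcount_orbit against t ^+ m for m < N; the last summand
    collects the two boundary terms of the shift of indices. *)
Lemma kneading_step N j t : (0 < j < n)%N ->
  orbit_sum N j t = sigma j * t * (orbit_sum N j.+1 t - orbit_sum N 1 t) +
    (zcount c 0 (x_ j) - zcount c N (x_ j) * t ^+ N).
Proof.
move=> jn.
have -> : sigma j * t * (orbit_sum N j.+1 t - orbit_sum N 1 t) =
    \sum_(m < N) zcount c m.+1 (x_ j) * t ^+ m.+1.
  rewrite /orbit_sum -sumrB mulr_sumr; apply: eq_bigr => m _.
  by rewrite zcount_orbit// orbit1 exprS; ring.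
have := @big_ord_recl _ 0 +%R N (fun m : 'I_N.+1 => zcount c m (x_ j) * t ^+ m).
rewrite big_ord_recr/= expr0 mulr1 /bump => E.
have -> : orbit_sum N j t = \sum_(i < N) zcount c i (x_ j) * t ^+ i by [].
move: E; under [in X in _ = X -> _]eq_bigr do rewrite add1n.
by move/(canRL (addrK _)) => ->; ring.
Qed.

(** Eliminate orbit_sum N j t for j = 2, 3, ... by means of kneading_step. For k = n.-1
    the first summand on the right vanishes, because the orbit has returned to 0. *)
Lemma kneading_partial N k t : (k < n)%N ->
  orbit_sum N 1 t * \sum_(j < k.+1) itinerary_sign j * t ^+ j =
  itinerary_sign k * t ^+ k * orbit_sum N k.+1 t +
  \sum_(j < k) itinerary_sign j * t ^+ j *
     (zcount c 0 (x_ j.+1) - zcount c N (x_ j.+1) * t ^+ N).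
Proof.
elim: k => [|k IH] kn.
  by rewrite big_ord1 big_ord0 /itinerary_sign big_ord0 expr0; ring.
rewrite big_ord_recr/= mulrDr IH 1?ltnW// [in RHS]big_ord_recr/=.
rewrite (kneading_step N t (j := k.+1))//.
have -> : itinerary_sign k.+1 = itinerary_sign k * sigma k.+1.
  by rewrite /itinerary_sign big_ord_recr.
rewrite exprS /=; ring.
Qed.

Lemma kneading_bound N t B : 0 <= t <= 1 -> zcount c N b * t ^+ N <= B ->
  `|orbit_sum N 1 t| * `|kneading_poly.[t]| <= n%:R * (1 + B).
Proof.
move=> /andP[t0 t1] tB; rewrite -normrM /kneading_poly horner_poly.
have pn : (n.-1 < n)%N by rewrite prednK.
have := kneading_partial N t pn; rewrite prednK// => ->.
have -> : orbit_sum N n t = 0.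
  by rewrite /orbit_sum big1// => m _; rewrite /x_ fn0 zcount0 mul0r.
rewrite mulr0 add0r; apply: le_trans (ler_norm_sum _ _ _) _.
have B0 : 0 <= B.
  by apply: le_trans tB; rewrite mulr_ge0 ?exprn_ge0// zcount_beta_ge0.
apply: (@le_trans _ _ (\sum_(j < n.-1) (1 + B))); last first.
  rewrite sumr_const card_ord -[leLHS]mulr_natl; apply: ler_wpM2r.
    exact: addr_ge0.
  by rewrite ler_nat leq_pred.
apply: ler_sum => j _; rewrite normrM normrM itinerary_sign_norm; last first.
  exact: leq_trans (ltn_ord j) (leq_pred n).
rewrite mul1r ger0_norm ?exprn_ge0// -[leRHS]mul1r; apply: ler_pM => //.
- exact: exprn_ge0.
- exact: exprn_ile1.
apply: le_trans (ler_normB _ _) _; apply: lerD.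
  by rewrite /zcount/=; case: sgrP => _; rewrite ?normrN ?normr1 ?normr0.
rewrite normrM (ger0_norm (exprn_ge0 _ _))//; apply: le_trans tB.
by rewrite ler_wpM2r ?exprn_ge0// zcount_orbit_le.
Qed.

Let critical_poly N : {poly R} := \poly_(m < N) (- zcount c m c).

Lemma critical_coef_ge0 m : 0 <= - zcount c m c.
Proof. by rewrite oppr_ge0 zcount_c_le0// ltW. Qed.

Lemma critical_polyE N t : (critical_poly N).[t] = - orbit_sum N 1 t.
Proof.
rewrite horner_poly /orbit_sum -sumrN; apply: eq_bigr => m _.
by rewrite orbit1 mulNr.
Qed.

(** For t < s^-1 the boundary terms in kneading_bound are under control by
    zcount_growth, and adding terms of constant sign only makes the partial sums
    larger; then let t tend to s^-1. *)
Lemma critical_poly_bound N : (critical_poly N).[s^-1] * `|kneading_poly.[s^-1]| <= n%:R * (1 + 2 * s).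
Proof.
have s1 : 1 <= s := growth_rate_ge1 c.
have s0 : 0 < s by lra.
have is0 : 0 < s^-1 by rewrite invr_gt0.
rewrite leNgt; apply/negP => bad.
pose g (t : R) := (critical_poly N).[t] * `|kneading_poly.[t]|.
have gc : g t @[t --> s^-1] --> g s^-1.
  by apply: cvgM; [|apply: cvg_norm]; exact: continuous_horner.
have : \forall t \near s^-1, n%:R * (1 + 2 * s) < g t by exact: cvgr_gt gc _ bad.
move=> /nbhs_ballP[e /= e0 eP].
(* The lower bound by (2 * s)^-1 keeps t^-1, which bounds the boundary terms, at most 2 * s. *)
pose t := Num.max ((2 * s)^-1) (s^-1 - e / 2).
have ts : t < s^-1.
  rewrite gt_max; apply/andP; split; last by lra.
  by rewrite ltf_pV2 ?posrE; lra.
have t0 : 0 < t by rewrite lt_max invr_gt0; apply/orP; left; lra.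
have t1 : t <= 1 by rewrite (le_trans (ltW ts))// invf_le1.
have te : ball (s^-1) e t.
  rewrite /ball/= gtr0_norm ?subr_gt0//.
  suff : s^-1 - e / 2 <= t by lra.
  by rewrite le_max lexx orbT.
have st : s < t^-1 by rewrite -[s]invrK ltf_pV2.
have [M MP] := zcount_growth c_itv n_gt0 fn0 st.
have : g t <= n%:R * (1 + 2 * s).
  apply: (@le_trans _ _ ((critical_poly (maxn M N)).[t] * `|kneading_poly.[t]|)).
    rewrite /g; apply: ler_wpM2r => //; rewrite !horner_poly.
    rewrite (big_ord_widen _ (fun m => - zcount c m c * t ^+ m) (leq_maxr M N)).
    rewrite big_mkcond/=; apply: ler_sum => m _; case: ifP => // _.
    by rewrite mulr_ge0 ?critical_coef_ge0 ?exprn_ge0// ltW.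
  have := @kneading_bound (maxn M N) t (2 * s); rewrite (ltW t0) t1 => /(_ isT) KB.
  apply: le_trans (KB _).
    by apply: ler_wpM2r => //; rewrite critical_polyE -normrN ler_norm.
  apply: (@le_trans _ _ (t^-1 ^+ (maxn M N).+1 * t ^+ maxn M N)).
    by apply: ler_wpM2r; rewrite ?exprn_ge0 ?(ltW t0)// MP// leq_maxl.
  rewrite exprS -mulrA -exprMn mulVf ?gt_eqF// expr1n mulr1.
  rewrite -[2 * s]invrK lef_pV2 ?posrE ?invr_gt0//; last by lra.
  by rewrite le_max lexx.
by rewrite leNgt eP.
Qed.

(** Summation by parts. *)
Lemma geometric_sum_diff (u : R) (a : nat -> R) N :
  (1 - u) * \sum_(m < N) a m * u ^+ m =
  a 0%N + u * \sum_(m < N) (a m.+1 - a m) * u ^+ m - a N * u ^+ N.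
Proof.
elim: N => [|N IH]; first by rewrite !big_ord0 expr0; ring.
by rewrite !big_ord_recr/= !mulrDr IH exprS; ring.
Qed.

(** The coefficients -zcount c m c are the increments of the number of zeros, which
    are themselves the increments of laps. If s > 1, two summations by parts bound
    the sum of the laps c m * s^-1 ^+ m for m < N in terms of the sum considered here,
    and growth_rate_laps makes every term at least 1. If s = 1, it suffices
    that 0 is a zero of the iterates whose order is a multiple of n, which
    contributes at least 1 to each of the corresponding coefficients. *)
Lemma critical_poly_unbounded B : exists N, B < (critical_poly N).[s^-1].
Proof.
have s1 : 1 <= s := growth_rate_ge1 c.
apply: contrapT => /forallNP SB.
have {}SB N : (critical_poly N).[s^-1] <= B by rewrite leNgt; apply/negP; exact: SB.
move: s1; rewrite le_eqVlt => /predU1P[s1|s1].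
  suff kS k : k%:R <= (critical_poly (k * n)).[s^-1].
    have B0 : 0 <= B by have := SB 0%N; rewrite horner_poly big_ord0.
    have := archi_boundP B0; rewrite ltNge; move/negP; apply.
    exact: le_trans (kS _) (SB _).
  rewrite -s1 invr1; elim: k => [|k IH]; first by rewrite horner_poly big_ord0.
  rewrite !horner_poly mulSn in IH *.
  have split_sum : \sum_(i < n + k * n) - zcount c i c * 1 ^+ i =
     \sum_(i < k * n) (- zcount c i c * 1 ^+ i) +
     \sum_(i < n) (- zcount c (k * n + i) c * 1 ^+ (k * n + i)).
    by rewrite addnC big_split_ord.
  rewrite split_sum -natr1; apply: lerD => //.
  rewrite -(prednK n_gt0) big_ord_recl/= addn0 expr1n mulr1 -[leLHS]addr0.
  apply: lerD; last first.
    by apply: sumr_ge0 => i _; rewrite mulr_ge0 ?critical_coef_ge0 ?exprn_ge0.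
  have fkn : iter (k * n) (quad c) 0 = 0.
    by elim: (k) => // k' IHk; rewrite mulSn iterD IHk.
  have c00 : c <= (0 : R) <= 0 by rewrite (ltW c_lt0) lexx.
  have := zcount_jump fkn c00 c_lt0; rewrite zcount0.
  by rewrite prednK//; move: (zcount c (k * n) c) => z; lra.
set u := s^-1.
have s0 : 0 < s by lra.
have u0 : 0 < u by rewrite invr_gt0.
have u1 : 0 < 1 - u by rewrite subr_gt0 invf_lt1.
have SE' N : \sum_(m < N) (zcount c m.+1 b - zcount c m b) * u ^+ m <= B.
  apply: le_trans (SB N); rewrite horner_poly; apply: ler_sum => m _.
  by rewrite zcountS_beta// addrAC subrr add0r.
have ZB N : (1 - u) * \sum_(m < N) zcount c m b * u ^+ m <= 1 + u * B.
  rewrite (geometric_sum_diff u (fun m => zcount c m b)) zcount0_beta// -[leRHS]subr0; apply: lerB.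
    by rewrite lerD2l; apply: ler_wpM2l; [exact: ltW|exact: SE'].
  by rewrite mulr_ge0 ?exprn_ge0 ?(ltW u0)// zcount_beta_ge0.
have LB N : (1 - u) * \sum_(m < N) laps c m * u ^+ m <= 1 + u * ((1 - u)^-1 * (1 + u * B)).
  rewrite (geometric_sum_diff u (laps c)) -[leRHS]subr0; apply: lerB; last first.
    by rewrite mulr_ge0 ?exprn_ge0 ?(ltW u0)// (le_trans _ (laps_ge1 _ _)).
  rewrite /laps big_ord0 addr0 lerD2l; apply: ler_wpM2l; first exact: ltW.
  rewrite mulrC ler_pdivlMr// mulrC; apply: le_trans (ZB N).
  apply: ler_wpM2l; first exact: ltW.
  by apply: ler_sum => m _; rewrite -/(laps c m) -/(laps c m.+1) lapsS addrAC subrr add0r.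
set C := 1 + u * _ in LB.
have NB N : N%:R <= (1 - u)^-1 * C.
  rewrite mulrC ler_pdivlMr// mulrC; apply: le_trans (LB N).
  apply: ler_wpM2l; first exact: ltW.
  rewrite -[X in X%:R]card_ord -sumr_const; apply: ler_sum => m _.
  rewrite exprVn ler_pdivlMr ?exprn_gt0// mul1r; exact: growth_rate_laps.
have := archi_boundP (le_trans (ler0n _ _) (NB 0%N)).
by rewrite ltNge NB.
Qed.

(** The product of the kneading polynomial and of partial sums that are unbounded at
    s^-1 remains bounded at s^-1. *)
Theorem kneading_root : \sum_(j < n) itinerary_sign j * s ^+ (n.-1 - j) = 0.
Proof.
have s1 : 1 <= s := growth_rate_ge1 c.
have s0 : 0 < s by lra.
have K0 : kneading_poly.[s^-1] = 0.
  apply/eqP/negPn/negP => K0.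
  have [N] := critical_poly_unbounded (n%:R * (1 + 2 * s) / `|kneading_poly.[s^-1]|).
  by rewrite ltNge ler_pdivlMr ?normr_gt0// critical_poly_bound.
have -> : \sum_(j < n) itinerary_sign j * s ^+ (n.-1 - j) =
    s ^+ n.-1 * kneading_poly.[s^-1].
  rewrite horner_poly mulr_sumr; apply: eq_bigr => j _.
  have jn : (j <= n.-1)%N by rewrite -ltnS prednK.
  rewrite mulrCA -{2}(subnK jn) exprD exprVn mulfK//.
  by rewrite expf_neq0 ?gt_eqF.
by rewrite K0 mulr0.
Qed.

End Kneading.

(** * Realizing a kneading sequence by a parameter *)

Section Realization.
Variables (R : realType) (n h : nat) (sigma : nat -> R).
Hypothesis sigma_pm1 : forall j, (0 < j < n)%N -> sigma j = 1 \/ sigma j = -1.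
Hypothesis sigma1 : sigma 1 = -1.
Hypothesis sigma_run : forall j, (1 < j <= h)%N -> sigma j = 1.
Hypothesis h_gt1 : (1 < h < n)%N.
Hypothesis n_le : (n <= h.*2)%N.

(** The i-th preimage of 0 along the branches prescribed by sigma, counted backwards
    from time n. As Num.sqrt vanishes on negative numbers this is defined and
    continuous for every c. *)
Fixpoint backward_orbit (i : nat) (c : R) : R :=
  if i is i'.+1 then sigma (n - i) * Num.sqrt (backward_orbit i' c - c) else 0.
Local Notation X := backward_orbit.

Lemma backward_orbit_continuous i : continuous (X i).
Proof.
elim: i => [|i IH] c; first exact: cvg_cst.
apply: cvgM; first exact: cvg_cst.
apply: continuous_comp; last exact: sqrt_continuous.
by apply: cvgB; [exact: IH|exact: cvg_id].
Qed.

Lemma backward_orbitE k c : (0 < k < n)%N ->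
  X (n - k) c = sigma k * Num.sqrt (X (n - k.+1) c - c).
Proof.
move=> /andP[_ kn]; rewrite -(subnSK kn) /= (subnSK kn).
by rewrite subKn// ltnW.
Qed.

Lemma sigma_mul_le k (y : R) : (0 < k < n)%N -> 0 <= y -> sigma k * y <= y.
Proof. by move=> /sigma_pm1[->|->] y0; lra. Qed.

Lemma backward_run_ge0 m c : (1 < m <= h)%N -> 0 <= X (n - m) c.
Proof.
move=> mh; rewrite backward_orbitE; last lia.
by rewrite sigma_run// mul1r sqrtr_ge0.
Qed.

(** During the initial run the signs are positive and the square root is monotone, so
    the comparison can be pushed forward until the orbit on the left reaches 0 at
    time n, which happens before the end of the run on the right. *)
Lemma backward_le_run i m c : (1 < m)%N -> (i + m <= h)%N -> X i c <= X (n - m) c.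
Proof.
elim: i m => [|i IH] m m1 imh; first by apply: backward_run_ge0; lia.
rewrite (@backward_orbitE m); last lia.
rewrite sigma_run ?mul1r; last lia.
apply: le_trans (_ : Num.sqrt (X i c - c) <= _).
  by apply: sigma_mul_le; [lia|exact: sqrtr_ge0].
by rewrite ler_wsqrtr// lerD2r; apply: IH; lia.
Qed.

(** Intermediate value theorem: at c = -2 the backward orbit stays in [-2, 2], and at
    c = -1 its value at time 2 is nonnegative, which forces the value at time 1 to be
    at most -1. *)
Lemma backward_solution : exists2 c : R, -2 <= c <= -1 & X n.-1 c = c.
Proof.
have Gc : continuous (fun c => X n.-1 c - c).
  by move=> c; apply: cvgB; [exact: backward_orbit_continuous|exact: cvg_id].
have := @IVT R (fun c => X n.-1 c - c) (-2) (-1) 0 _ _.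
case.
- lra.
- exact: continuous_subspaceT.
- apply/andP; split.
    rewrite ge_min; apply/orP; right.
    rewrite -subn1 backward_orbitE; last lia.
    rewrite sigma1.
    have : 1 <= Num.sqrt (X (n - 2) (-1) - -1).
      rewrite -[X in X <= _]sqrtr1 ler_wsqrtr// opprK lerDr.
      by apply: backward_run_ge0; lia.
    by move: (Num.sqrt _) => w; lra.
  rewrite le_max; apply/orP; left.
  have XB i : (i < n)%N -> `|X i (-2)| <= 2.
    elim: i => [|i IH] i_n; first by rewrite normr0.
    rewrite /= normrM (ger0_norm (sqrtr_ge0 _)).
    have -> : `|sigma (n - i.+1)| = 1.
      have : (0 < n - i.+1 < n)%N by lia.
      by move=> /sigma_pm1[->|->]; rewrite ?normrN normr1.
    have s4 : Num.sqrt (2 ^+ 2) = 2 :> R by rewrite sqrtr_sqr ger0_norm.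
    rewrite mul1r -[leRHS]s4.
    rewrite ler_wsqrtr//.
    by have := IH (ltnW i_n); rewrite ler_norml; move: (X i _) => w; lra.
  have := XB n.-1; rewrite ler_norml; move: (X _ _) => w /(_ _) H.
  have /H : (n.-1 < n)%N by lia.
  by lra.
move=> c; rewrite in_itv/= => cI; move=> /eqP; rewrite subr_eq0 => /eqP Xc.
by exists c.
Qed.

(** A solution of backward_orbit n.-1 c = c gives a true orbit as soon as every square root in
    backward_orbit is taken of a nonnegative number, that is if the minimum of the
    orbit is at time 1. This is what the length of the run ensures. *)
Theorem realization : exists c : R, [/\ -2 <= c <= -1, iter n (quad c) 0 = 0 &
  forall j, (0 < j < n)%N -> 0 <= sigma j * iter j (quad c) 0].
Proof.
have [c cI Xc] := backward_solution; exists c.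
have Xge i : (i < n)%N -> c <= X i c.
  case: i => [|i] i_n; first by rewrite /=; lra.
  have jn : (0 < n - i.+1 < n)%N by lia.
  rewrite /=; have s0 := sqrtr_ge0 (X i c - c).
  case: (sigma_pm1 jn) => sj; rewrite sj ?mul1r; first by apply: le_trans s0; lra.
  (* Time 1 is the equation solved by c; other negative signs occur only after the run. *)
have [j1|j1] := eqVneq (n - i.+1)%N 1%N.
    by rewrite -{1}Xc (_ : n.-1 = i.+1)/= ?sj//; lia.
  have hj : (h < n - i.+1)%N.
    rewrite ltnNge; apply/negP => jh; move: sj; rewrite sigma_run; last lia.
    by move=> ?; lra.
  rewrite -{1}Xc -subn1 backward_orbitE; last lia.
  rewrite sigma1 !mulN1r lerN2 ler_wsqrtr// lerD2r.
  by apply: backward_le_run; lia.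
have orb k : (0 < k <= n)%N -> iter k (quad c) 0 = X (n - k) c.
  case: k => // k; elim: k => [|k IH] kn.
    by rewrite /= /quad expr0n add0r subn1 Xc.
  rewrite iterS IH; last lia.
  rewrite backward_orbitE; last lia.
  rewrite /quad exprMn sqr_sqrtr; last by rewrite subr_ge0; apply: Xge; lia.
  have : (0 < k.+1 < n)%N by lia.
  by move=> /sigma_pm1[->|->]; rewrite ?sqrrN expr1n mul1r subrK.
split=> //.
  by rewrite orb ?subnn//; lia.
move=> j jn; rewrite orb; last lia.
rewrite backward_orbitE// mulrA.
have -> : sigma j * sigma j = 1.
  by case: (sigma_pm1 jn) => ->; rewrite ?mulrNN mulr1.
by rewrite mul1r sqrtr_ge0.
Qed.

End Realization.

(** * Irreducible polynomials with coefficients 1 and -1 *)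

Section Irreducibility.

Lemma irreducible_comp_XaddC (F : fieldType) (p : {poly F}) (a : F) :
  irreducible_poly (p \Po ('X + a%:P)) -> irreducible_poly p.
Proof.
have sX : size ('X + a%:P) = 2 by rewrite size_XaddC.
case; rewrite size_comp_poly2// => p1 irr; split=> // q q1 qp.
have := irr (q \Po ('X + a%:P)); rewrite size_comp_poly2// => /(_ q1).
move=> /(_ (dvdp_comp_poly _ qp))/eqp_size/eqP.
by rewrite !size_comp_poly2// dvdp_size_eqp.
Qed.

(** In characteristic 2, 1 + x + ... + x^(2^r-1) is (x - 1)^(2^r-1), as one sees after
    multiplication by x - 1. *)
Lemma poly_F2_pow2 r : \poly_(i < 2 ^ r) (1 : 'F_2) \Po ('X + 1) = 'X^((2 ^ r).-1).
Proof.
have p2 : 2 \in [pchar {poly 'F_2}].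
  by rewrite (rmorph_pchar (polyC : {rmorphism 'F_2 -> {poly 'F_2}}))// pchar_Fp.
have n0 : (0 < 2 ^ r)%N by rewrite expn_gt0.
apply: (@mulfI _ 'X); first by rewrite polyX_eq0.
rewrite -exprS prednK// poly_def.
have -> : \sum_(i < 2 ^ r) (1 : 'F_2) *: 'X^i = \sum_(i < 2 ^ r) 'X^i.
  by apply: eq_bigr => i _; rewrite scale1r.
have {1}-> : 'X = ('X - 1) \Po ('X + 1) :> {poly 'F_2}.
  by rewrite comp_polyB comp_polyX comp_polyC addrK.
rewrite -comp_polyM -subrX1 comp_polyB comp_polyC rmorphXn/= comp_polyX.
rewrite exprDn_pchar; first by rewrite expr1n addrK.
by rewrite pnatX pnatE// p2.
Qed.

(** Eisenstein's criterion at 2 after the translation x -> x + 1; the constant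
    coefficient becomes the value at 1. *)
Lemma pm1_irreducible r (q : nat -> int) : (0 < r)%N ->
  (forall i, q i = 1 \/ q i = -1) -> ~~ (4 %| \sum_(i < 2 ^ r) q i)%Z ->
  irreducible_poly (map_poly intr (\poly_(i < 2 ^ r) q i) : {poly rat}).
Proof.
move=> r0 qpm q4; set P := \poly_(i < _) _.
have n1 : (1 < 2 ^ r)%N by rewrite -{1}(expn0 2) ltn_exp2l.
have q0 i : q i != 0 by case: (qpm i) => ->.
have sP : size P = (2 ^ r)%N by rewrite size_poly_eq.
have sX : size ('X + 1 : {poly int}) = 2 by rewrite size_XaddC.
have mX : map_poly intr ('X + 1%:P) = 'X + 1%:P :> {poly rat}.
  by rewrite rmorphD/= map_polyX map_polyC.
apply: (@irreducible_comp_XaddC _ _ 1).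
rewrite -mX -map_comp_poly; apply/irreducible_rat_int.
apply: (@eisenstein_crit 2) => //.
- by rewrite size_comp_poly2// sP; case: (2 ^ r)%N n1 => // -[].
- rewrite lead_coef_comp ?sX// lead_coefXaddC expr1n mulr1 lead_coefE sP.
  rewrite coef_poly ltn_predL (ltnW n1).
  by case: (qpm (2 ^ r).-1) => ->.
- rewrite -horner_coef0 horner_comp !hornerE horner_poly.
  by under eq_bigr do rewrite expr1n mulr1.
rewrite size_comp_poly2// sP => i i_n.
rewrite (dvdz_pcharf (pchar_Fp _))// -coef_map map_comp_poly rmorphD/= map_polyX map_polyC/=.
have -> : map_poly intr P = \poly_(i < 2 ^ r) (1 : 'F_2).
  apply/polyP => j; rewrite coef_map !coef_poly; case: ifP => // _.
  by case: (qpm j) => ->; rewrite ?rmorphN1 ?rmorph1//; apply/eqP.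
by rewrite poly_F2_pow2 coefXn ltn_eqF.
Qed.

Lemma min_poly_dvdp (R : realType) (p q : {poly rat}) (z : R[i]%C) :
  is_min_poly p z -> root (map_poly ratr q) z -> p %| q.
Proof.
case=> pm pz pmin qz; apply/modp_eq0P/eqP/negPn/negP => r0.
have : root (map_poly ratr (q %% p)) z.
  have := congr1 (fun u => (map_poly ratr u).[z]) (divp_eq q p).
  rewrite rmorphD rmorphM/= hornerD hornerM (rootP pz) (rootP qz) mulr0 add0r.
  by move=> /esym/rootP.
move/(pmin _ r0); rewrite leqNgt ltn_modp; apply/negP/negPn.
exact: monic_neq0.
Qed.

Lemma irreducible_min_poly (R : realType) (p : {poly rat}) (z : R[i]%C) :
  p \is monic -> irreducible_poly p -> root (map_poly ratr p) z -> is_min_poly p z.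
Proof.
move=> pm [p1 irr] pz; split=> // q q0 qz.
have dz : root (map_poly ratr (gcdp p q)) z by rewrite gcdp_map root_gcd pz qz.
have d1 : size (gcdp p q) != 1%N.
  apply/negP => /size_poly1P[a a0 dE]; move: dz.
  by rewrite dE map_polyC rootC fmorph_eq0 (negbTE a0).
have /eqp_size <- := irr _ d1 (dvdp_gcdl p q).
by apply: dvdp_leq => //; exact: dvdp_gcdr.
Qed.

End Irreducibility.

(** * Roots of polynomials with unimodular coefficients *)

Section Jensen.
Variable C : numClosedFieldType.
Implicit Types (p g : {poly C}) (a z : C).

(** The square of the norm in the Hardy space of the unit disk. *)
Definition sqnorm p : C := \sum_(i < size p) `|p`_i| ^+ 2.

Lemma sqnormE N p : (size p <= N)%N -> sqnorm p = \sum_(i < N) `|p`_i| ^+ 2.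
Proof.
move=> pN; rewrite /sqnorm (big_ord_widen _ (fun i => `|p`_i| ^+ 2) pN) big_mkcond.
apply: eq_bigr => i _; case: ltnP => // pi.
by rewrite nth_default// normr0 expr0n.
Qed.

Lemma coef0_sqnorm p : `|p`_0| ^+ 2 <= sqnorm p.
Proof.
rewrite (@sqnormE (size p).+1) // big_ord_recl lerDl.
by apply: sumr_ge0 => i _; rewrite exprn_ge0.
Qed.

(** On the unit circle |x - a| = |1 - a^* x|. Coefficientwise, the cross terms agree
    and the rest telescopes. *)
Lemma sqnorm_blaschke1 g a :
  sqnorm (('X - a%:P) * g) = sqnorm ((1 - a^* *: 'X) * g).
Proof.
have s1 : (size (('X - a%:P) * g)%R <= (size g).+1)%N.
  by apply: leq_trans (size_polyMleq _ _) _; rewrite size_XsubC.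
have s2 : (size ((1 - a^* *: 'X) * g)%R <= (size g).+1)%N.
  apply: leq_trans (size_polyMleq _ _) _.
  have : (size (1 - a^* *: 'X : {poly C})%R <= 2)%N.
    apply: leq_trans (size_polyD _ _) _; rewrite size_polyN size_poly1 geq_max/=.
    by apply: leq_trans (size_scale_leq _ _) _; rewrite size_polyX.
  by move=> h; rewrite -subn1 leq_subLR add1n -add2n leq_add2r.
rewrite (sqnormE s1) (sqnormE s2); apply/eqP; rewrite -subr_eq0 -sumrB; apply/eqP.
(* The difference of the coefficients of index i is a multiple of h i.+1 - h i. *)
pose h (i : nat) : C := if i is i'.+1 then `|g`_i'| ^+ 2 else 0.
have E (i : 'I_(size g).+1) : `|(('X - a%:P) * g)`_i| ^+ 2 -
    `|((1 - a^* *: 'X) * g)`_i| ^+ 2 = (h i.+1 - h i) * (`|a| ^+ 2 - 1).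
  rewrite !mulrBl mul1r -scalerAl coefB [in X in _ - X]coefB coefZ coefXM coefCM.
  rewrite /h; case: (i : nat) => [|j] /=.
    by rewrite mulr0 subr0 !normCK !rmorphB/= !rmorph0 !rmorphM/= ; ring.
  by rewrite !normCK !rmorphB/= !rmorphM/= !conjCK; ring.
rewrite (eq_bigr _ (fun i _ => E i)) -mulr_suml.
rewrite -(big_mkord xpredT (fun i => h i.+1 - h i)) telescope_sumr// /h.
by rewrite nth_default// normr0 expr0n subr0 mul0r.
Qed.

Lemma sqnorm_blaschke k g a :
  sqnorm (('X - a%:P) ^+ k * g) = sqnorm ((1 - a^* *: 'X) ^+ k * g).
Proof.
elim: k g => [|k IH] g; first by rewrite !expr0.
rewrite exprSr -mulrA IH mulrCA sqnorm_blaschke1 exprS mulrA//.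
Qed.

(** Replacing the factors x - a by 1 - a^* x preserves the norm and divides the value
    at 0 by (-a)^k. *)
Lemma jensen k g a :
  `|(('X - a%:P) ^+ k * g).[0]| ^+ 2 <= `|a| ^+ (k * 2) * sqnorm (('X - a%:P) ^+ k * g).
Proof.
rewrite sqnorm_blaschke; apply: le_trans (_ : `|a| ^+ (k * 2) * `|g`_0| ^+ 2 <= _).
  by rewrite hornerM horner_exp hornerXsubC sub0r horner_coef0 normrM normrX normrN
    exprMn exprM.
apply: ler_wpM2l; first exact: exprn_ge0.
apply: le_trans (coef0_sqnorm _).
by rewrite -!horner_coef0 hornerM horner_exp !hornerE ?mulr0 ?subr0 ?expr1n ?mul1r.
Qed.

(** The coefficient is the full product times an elementary symmetric function of the
    inverses of the b's, which are at most d^-1 in modulus. *)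
Lemma coef_prod_XaddC (s : seq C) d k : 0 < d -> {in s, forall b, d <= `|b|} ->
  `|(\prod_(b <- s) ('X + b%:P))`_k| <= (\prod_(b <- s) `|b|) * ((size s)%:R / d) ^+ k.
Proof.
move=> d0; elim: s k => [|b s IH] k sd.
  rewrite !big_nil mul1r mul0r coef1 expr0n; case: k => [|k]; by rewrite ?normr1 ?normr0.
have sd' : {in s, forall b, d <= `|b|} by move=> x xs; apply: sd; rewrite inE xs orbT.
have db : d <= `|b| by apply: sd; rewrite mem_head.
have b0 : 0 < `|b| := lt_le_trans d0 db.
rewrite !big_cons mulrDl coefD coefXM coefCM /=.
set P := \prod_(b <- s) _; set M := \prod_(b <- s) `|b|.
set l : C := (size s)%:R; have M0 : 0 <= M by apply: prodr_ge0.
have l0 : 0 <= l / d by rewrite divr_ge0 ?ler0n ?ltW.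
case: k => [|k] /=.
  rewrite add0r normrM !expr0 !mulr1; apply: ler_wpM2l => //.
  by have := IH 0%N sd'; rewrite expr0 mulr1.
apply: le_trans (ler_normD _ _) _.
apply: le_trans (_ : M * (l / d) ^+ k + `|b| * (M * (l / d) ^+ k.+1) <= _).
  by apply: lerD; [exact: IH|rewrite normrM; apply: ler_wpM2l => //; exact: IH].
have -> : (size s).+1%:R / d = l / d + d^-1 by rewrite -natr1 mulrDl mul1r.
have y0 : 0 <= d^-1 by rewrite invr_ge0 ltW.
have by1 : 1 <= `|b| / d by rewrite ler_pdivlMr ?mul1r.
move: d^-1 (l / d) l0 y0 by1 => y x x0 y0 by1.
have xk : 0 <= x ^+ k by exact: exprn_ge0.
apply: le_trans (_ : `|b| * M * (x ^+ k * (x + y)) <= _).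
  have -> : `|b| * M * (x ^+ k * (x + y)) =
      (`|b| * y) * (M * x ^+ k) + `|b| * (M * x ^+ k.+1) by rewrite exprS; ring.
  by rewrite lerD2r ler_peMl// mulr_ge0.
apply: ler_wpM2l; first by rewrite mulr_ge0.
rewrite exprSr; apply: ler_wpM2r; first exact: addr_ge0.
by apply: lerXn2r; rewrite ?nnegrE ?addr_ge0// lerDl.
Qed.

Lemma coef_exp_XsubC z k i : `|z| <= 1 -> `|(('X - z%:P) ^+ k)`_i| <= 2 ^+ k.
Proof.
move=> z1; elim: k i => [|k IH] i.
  by rewrite !expr0 coef1; case: eqP => _; rewrite ?normr1 ?normr0 ?ler01.
rewrite [in leLHS]exprS mulrBl coefB coefXM coefCM exprS mulr_natl mulr2n.
apply: le_trans (ler_normB _ _) _; apply: lerD.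
  by case: eqP => // _; rewrite normr0 exprn_ge0.
by rewrite normrM -[leRHS]mul1r; apply: ler_pM => //.
Qed.

Lemma coef_comp_scaleX p a i : (p \Po (a *: 'X))`_i = p`_i * a ^+ i.
Proof.
have -> : p \Po (a *: 'X) = \poly_(j < size p) (p`_j * a ^+ j).
  by rewrite comp_polyE poly_def; apply: eq_bigr => j _; rewrite exprZn scalerA.
by rewrite coef_poly; case: ltnP => // pi; rewrite nth_default// mul0r.
Qed.

Lemma sqr_normB_le (u v : C) : `|u - v| ^+ 2 <= 2 * `|u| ^+ 2 + 2 * `|v| ^+ 2.
Proof.
have -> : 2 * `|u| ^+ 2 + 2 * `|v| ^+ 2 = `|u - v| ^+ 2 + `|u + v| ^+ 2.
  by rewrite !normCK rmorphB rmorphD/=; ring.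
by rewrite lerDl exprn_ge0.
Qed.

Lemma geometric_sum_le (q : C) N : 0 <= q < 1 -> \sum_(i < N) q ^+ i <= (1 - q)^-1.
Proof.
move=> /andP[q0 q1]; have q1' : 0 < 1 - q by rewrite subr_gt0.
rewrite -div1r ler_pdivlMr// mulrC -[X in X <= _]opprK -mulNr opprB -subrX1 opprB.
by rewrite gerBl exprn_ge0.
Qed.

Lemma taylor_coef_le (Q : {poly C}) z d k : 0 < d -> Q != 0 ->
  (forall w, root Q w -> d <= `|z - w|) ->
  `|(Q \Po ('X + z%:P))`_k| <= `|Q.[z]| * ((size Q)%:R / d) ^+ k.
Proof.
move=> d0 Q0 far; have [r QE] := closed_field_poly_normal Q.
have lc0 : lead_coef Q != 0 by rewrite lead_coef_eq0.
have TE : Q \Po ('X + z%:P) = lead_coef Q *: \prod_(b <- [seq z - w | w <- r]) ('X + b%:P).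
  rewrite {1}QE comp_polyZ rmorph_prod/= big_map; congr (_ *: _).
  apply: eq_bigr => w _.
  by rewrite comp_polyB comp_polyX comp_polyC polyCB addrA.
have rQ w : w \in r -> root Q w.
  by move=> wr; rewrite QE rootZ// root_prod_XsubC.
rewrite TE coefZ normrM.
have -> : `|Q.[z]| = `|lead_coef Q| * \prod_(b <- [seq z - w | w <- r]) `|b|.
  rewrite {1}QE hornerZ normrM horner_prod normr_prod big_map; congr (_ * _).
  by apply: eq_bigr => w _; rewrite hornerXsubC.
rewrite -mulrA; apply: ler_wpM2l => //.
apply: le_trans (coef_prod_XaddC _ d0 _) _.
  by move=> _ /mapP[w wr ->]; apply: far; exact: rQ.
apply: ler_wpM2l; first exact: prodr_ge0.
have rs : (size r <= size Q)%N.
  by rewrite QE size_scale// size_prod_XsubC.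
apply: lerXn2r; rewrite ?nnegrE ?divr_ge0 ?ler0n ?(ltW d0)//.
by apply: ler_wpM2r; [rewrite invr_ge0 ltW|rewrite ler_nat size_map].
Qed.

(** Suppose that no root is within d of z. Then A bounds the Taylor coefficients of
    order at most K at z, and E the coefficients of the Taylor polynomial S of order
    K. As (x - z)^K divides Q - S, the inequality of Jensen on the disk of radius rho
    bounds |Q(0) - S(0)|, which is close to 1, by less than 1/2. The norm
    of Q on this disk is bounded independently of the degree, as the coefficients of
    Q have modulus 1. *)
Lemma near_root (Q : {poly C}) (z rho d : C) (K : nat) :
  0 < d <= 1 -> `|z| < rho < 1 -> Q != 0 ->
  (forall i, (i < size Q)%N -> `|Q`_i| = 1) ->
  (`|z| / rho) ^+ (K * 2) * (2 / (1 - rho ^+ 2) + 2) < 4^-1 ->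
  K.+1%:R * (K%:R * (`|Q.[z]| * ((size Q)%:R / d) ^+ K * 2 ^+ K)) <= 2^-1 ->
  exists2 w, root Q w & `|z - w| < d.
Proof.
move=> /andP[d0 d1] /andP[zr r1] Q0 Q1 theta small.
have r0 : 0 < rho by exact: le_lt_trans zr.
have z1 : `|z| <= 1 by rewrite ltW// (lt_trans zr).
have [r QE] := closed_field_poly_normal Q.
have [/hasP[w wr wz]|/hasPn far] := boolP (has (fun w => `|z - w| < d) r).
  by exists w => //; rewrite QE rootZ ?lead_coef_eq0// root_prod_XsubC.
have {}far w : root Q w -> d <= `|z - w|.
  rewrite QE rootZ ?lead_coef_eq0// root_prod_XsubC => /far.
  by rewrite -real_leNgt ?normr_real// gtr0_real.
exfalso; set n := size Q in small.
have n0 : (0 < n)%N by rewrite size_poly_gt0.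
have nd : 1 <= n%:R / d.
  rewrite ler_pdivlMr// mul1r (le_trans d1)// ler1n//.
pose T := Q \Po ('X + z%:P).
set A := `|Q.[z]| * (n%:R / d) ^+ K in small.
set E := K%:R * (A * 2 ^+ K) in small.
have A0 : 0 <= A by rewrite mulr_ge0// exprn_ge0// (le_trans ler01).
have E0 : 0 <= E.
  by apply: mulr_ge0; [exact: ler0n|apply: mulr_ge0 => //; exact: exprn_ge0].
have TA k : (k <= K)%N -> `|T`_k| <= A.
  move=> kK; apply: le_trans (taylor_coef_le k d0 Q0 far) _.
  by apply: ler_wpM2l => //; apply: ler_weXn2l.
pose S := take_poly K T \Po ('X - z%:P).
have SE i : `|S`_i| <= E.
  rewrite /S /take_poly poly_def raddf_sum/= coef_sum.
  apply: le_trans (ler_norm_sum _ _ _) _.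
  apply: (@le_trans _ _ (\sum_(k < K) (A * 2 ^+ K))); last first.
    by rewrite sumr_const card_ord -[leLHS]mulr_natl.
  apply: ler_sum => k _; rewrite comp_polyZ coefZ normrM comp_Xn_poly.
  apply: ler_pM => //; first by apply: TA; exact: ltnW.
  apply: le_trans (coef_exp_XsubC _ _ z1) _.
  by apply: ler_weXn2l; rewrite ?ler1n// ltnW.
have sS : (size S <= K)%N.
  by rewrite size_comp_poly2 ?size_XsubC// size_take_poly.
have decomp : Q - S = ('X - z%:P) ^+ K * (drop_poly K T \Po ('X - z%:P)).
  have {1}-> : Q = T \Po ('X - z%:P).
    by rewrite -comp_polyA comp_polyD comp_polyX comp_polyC subrK comp_polyXr.
  rewrite -{1}(poly_take_drop K T) comp_polyD /S addrC addKr.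
  by rewrite comp_polyM comp_Xn_poly mulrC.
pose P := (Q - S) \Po (rho *: 'X).
have PE : P = ('X - (z / rho)%:P) ^+ K *
    (rho ^+ K *: ((drop_poly K T \Po ('X - z%:P)) \Po (rho *: 'X))).
  rewrite /P decomp comp_polyM; set g := _ \Po (rho *: 'X).
  rewrite rmorphXn/= comp_polyB comp_polyX comp_polyC -scalerAr scalerAl -exprZn.
  congr (_ ^+ _ * _); rewrite scalerBr -[rho *: (z / rho)%:P]mul_polyC -polyCM.
  by rewrite mulrCA divff ?mulr1// gt_eqF.
have coefP i : P`_i = (Q`_i - S`_i) * rho ^+ i by rewrite coef_comp_scaleX coefB.
have E2 : E <= 2^-1.
  apply: le_trans small; rewrite -[leLHS]mul1r; apply: ler_wpM2r => //.
  by rewrite ler1n.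
have KE : K%:R * E ^+ 2 <= 1.
  rewrite expr2 mulrA -[leRHS]mulr1; apply: ler_pM => //.
  - by rewrite mulr_ge0.
  - apply: (@le_trans _ _ 2^-1); last by rewrite invf_le1 ?ler1n// ltr0n.
    by apply: le_trans small; apply: ler_wpM2r => //; rewrite ler_nat.
  - by apply: (le_trans E2); rewrite invf_le1 ?ler1n// ltr0n.
have normP : sqnorm P <= 2 / (1 - rho ^+ 2) + 2.
  set N := maxn n K.
  have PN : (size P <= N)%N.
    apply/leq_sizeP => i; rewrite geq_max => /andP[ni Ki].
    by rewrite coefP !nth_default ?subrr ?mul0r// (leq_trans sS).
  rewrite (sqnormE PN).
  apply: le_trans (_ : \sum_(i < N) (2 * (rho ^+ 2) ^+ i + 2 * `|S`_i| ^+ 2) <= _).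
    apply: ler_sum => i _; rewrite coefP normrM exprMn.
    have ri : `|rho ^+ i| ^+ 2 = (rho ^+ 2) ^+ i.
      by rewrite ger0_norm ?exprn_ge0 ?ltW// exprAC.
    have ri1 : (rho ^+ 2) ^+ i <= 1 by rewrite -exprM exprn_ile1// ltW.
    have ri0 : 0 <= (rho ^+ 2) ^+ i by rewrite -exprM exprn_ge0// ltW.
    rewrite ri; apply: le_trans (ler_wpM2r ri0 (sqr_normB_le _ _)) _.
    rewrite mulrDl; apply: lerD.
      rewrite -mulrA; apply: ler_wpM2l => //; rewrite -[leRHS]mul1r.
      apply: ler_wpM2r => //; case: (ltnP i n) => [/Q1 ->|ni].
        by rewrite expr1n.
      by rewrite nth_default// normr0 expr0n.
    by rewrite -[leRHS]mulr1; apply: ler_wpM2l => //; rewrite mulr_ge0// exprn_ge0.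
  rewrite big_split/= -!mulr_sumr; apply: lerD.
    apply: ler_wpM2l => //; apply: geometric_sum_le.
    by rewrite exprn_ge0 ?(ltW r0)// exprn_ilt1// ltW.
  rewrite -[leRHS]mulr1; apply: ler_wpM2l => //.
  rewrite -(@sqnormE N) ?(leq_trans sS) ?leq_maxr// (sqnormE sS).
  apply: le_trans KE; rewrite mulr_natl -[X in _ *+ X]card_ord -sumr_const.
  by apply: ler_sum => i _; apply: lerXn2r; rewrite ?nnegrE.
have P0 : 4^-1 <= `|P.[0]| ^+ 2.
  rewrite horner_coef0 coefP expr0 mulr1.
  have -> : 4^-1 = 2^-1 ^+ 2 :> C by rewrite exprVn expr2 -natrM.
  apply: lerXn2r; rewrite ?nnegrE ?invr_ge0 ?ler0n//.
  apply: le_trans (lerB_dist _ _); rewrite Q1//.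
  have {1}-> : 2^-1 = 1 - 2^-1 :> C by rewrite [X in X - _](splitr 1) mul1r addrK.
  by apply: lerB => //; exact: le_trans (SE 0%N) E2.
have := jensen K (rho ^+ K *: ((drop_poly K T \Po ('X - z%:P)) \Po (rho *: 'X))) (z / rho).
rewrite -PE => J.
suff : 4^-1 < 4^-1 :> C by rewrite ltxx.
apply: le_lt_trans (le_trans P0 J) _; apply: le_lt_trans theta.
rewrite normrM normfV (gtr0_norm r0).
by apply: ler_wpM2l => //; rewrite exprn_ge0// divr_ge0// ltW.
Qed.

End Jensen.

Local Open Scope complex_scope.

(** * Conjugates of growth rates *)

Section SpectralPoly.
Variable R : realType.
Implicit Types (c : R) (q : nat -> int).

(** The coefficients q are the partial products of the signs of the critical orbit in
    reverse order, hence consecutive products of q recover these signs. *)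
Lemma kneading_int_root c n q : -2 <= c -> c < 0 -> (0 < n)%N ->
  iter n (quad c) 0 = 0 -> (forall i, q i = 1 \/ q i = -1) -> q n.-1 = 1 ->
  (forall j, (0 < j < n)%N ->
     0 <= (q (n.-1 - j)%N * q (n - j)%N)%:~R * iter j (quad c) 0) ->
  \sum_(i < n) (q i)%:~R * growth_rate c ^+ i = 0.
Proof.
move=> c2 c0 n0 fn qpm qn sgn.
have c_itv : -2 <= c <= 1 / 4 by rewrite c2/=; lra.
pose sg (j : nat) : R := (q (n.-1 - j)%N * q (n - j)%N)%:~R.
have sg_pm j : sg j = 1 \/ sg j = -1.
  rewrite /sg; case: (qpm (n.-1 - j)%N) => ->; case: (qpm (n - j)%N) => ->;
  rewrite ?mulr1 ?mulrNN ?mulN1r ?mulr1; by [left|right].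
have := @kneading_root R c n sg c_itv c0 n0 fn (fun j _ => sg_pm j) sgn.
rewrite (reindex_inj rev_ord_inj)/= => H; rewrite -[RHS]H.
apply: eq_bigr => i _.
have iE : (n.-1 - (n - i.+1) = i)%N by have := ltn_ord i; lia.
rewrite iE; congr (_ * _).
have sgE j : (j < n)%N -> itinerary_sign sg j = (q (n.-1 - j)%N)%:~R.
  elim: j => [|j IH] jn; first by rewrite /itinerary_sign big_ord0 subn0 qn.
  have -> : itinerary_sign sg j.+1 = itinerary_sign sg j * sg j.+1.
    by rewrite /itinerary_sign big_ord_recr.
  rewrite IH 1?ltnW// /sg (_ : n - j.+1 = n.-1 - j)%N; last by lia.
  rewrite rmorphM/= mulrCA -expr2.
  by case: (qpm (n.-1 - j)%N) => ->; rewrite ?rmorphN ?sqrrN expr1n mulr1.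
by rewrite sgE ?iE//; have := ltn_ord i; lia.
Qed.

Definition intpoly n q : {poly rat} := map_poly intr (\poly_(i < n) q i).

Lemma map_intpoly n q :
  map_poly ratr (intpoly n q) = \poly_(i < n) (q i)%:~R :> {poly R[i]}.
Proof.
apply/polyP => i; rewrite !coef_map !coef_poly /=; case: ifP => _.
  by rewrite ratr_int.
by rewrite !rmorph0.
Qed.

Lemma intpoly_growth_root c n q :
  \sum_(i < n) (q i)%:~R * growth_rate c ^+ i = 0 ->
  root (map_poly ratr (intpoly n q)) (growth_rate c)%:C.
Proof.
move=> s0; apply/rootP; rewrite map_intpoly horner_poly.
rewrite -[RHS](rmorph0 (real_complex R)) -s0 rmorph_sum/=; apply: eq_bigr => i _.
by rewrite rmorphM rmorphXn/= rmorph_int.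
Qed.

(** For c = 0 the iterates have the single zero 0, so the number of laps is linear. *)
Lemma growth_rate0 : growth_rate (0 : R) = 1.
Proof.
have c_itv : -2 <= (0 : R) <= 1 / 4 by lra.
have s1 : 1 <= growth_rate (0 : R) := growth_rate_ge1 0.
apply/eqP; rewrite eq_le s1 andbT leNgt; apply/negP => s1'.
set s := growth_rate 0 in s1 s1'.
have z1 k : zcount 0 k (beta_fix (0 : R)) = 1.
  elim: k => [|k IH]; first exact: zcount0_beta.
  by rewrite zcountS_beta// IH zcount0 subr0.
have sm m : s ^+ m <= 1 + m%:R.
  apply: le_trans (growth_rate_laps c_itv m) _.
  by rewrite /laps (eq_bigr (fun=> 1)) ?sumr_const ?card_ord// => i _; rewrite z1.
set w := Num.sqrt s.
have w1 : 1 < w by rewrite -sqrtr1 ltr_sqrt//; lra.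
have w0 : 0 < w by lra.
have w2 : w ^+ 2 = s by rewrite sqr_sqrtr//; lra.
have q01 : 0 <= w^-1 < 1 by rewrite invr_ge0 (ltW w0) invf_lt1.
set B := (1 - w^-1)^-1.
have mB m : m%:R <= B * w ^+ m.
  by have := mulrn_exp_le m q01; rewrite exprVn ler_pdivrMr ?exprn_gt0.
have m2 m : m%:R ^+ 2 <= B ^+ 2 * (1 + m%:R).
  apply: le_trans (_ : (B * w ^+ m) ^+ 2 <= _).
    by apply: lerXn2r; rewrite ?nnegrE ?ler0n//; apply: le_trans (mB m).
  rewrite exprMn exprAC w2; apply: ler_wpM2l => //; exact: sqr_ge0.
have B20 : 0 <= 2 * B ^+ 2 by rewrite mulr_ge0// sqr_ge0.
have := archi_boundP B20; set m := Num.bound _ => mb.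
have m1 : 1 <= m%:R :> R.
  by rewrite ler1n lt0n; apply: contraTneq mb => ->; rewrite -leNgt.
have := m2 m; move: mb m1 B20; move: (B ^+ 2) (m%:R : R) => b t; nra.
Qed.

(** The sign of c separates the cases: the critical orbit of a positive parameter is
    positive, hence not periodic, and for c = 0 the growth rate is 1, a root of 1 - x. *)
Lemma gal_growth_pm1 c (z : R[i]) : superattracting R c ->
  Gal (growth_rate c)%:C z -> `|z| < 1 ->
  exists n (q : nat -> int), [/\ (0 < n)%N, forall i, q i = 1 \/ q i = -1 &
    \sum_(i < n) (q i)%:~R * z ^+ i = 0].
Proof.
move=> [/andP[c2 c4] [n n0 fn]] [p pmin pz] z1.
have pm1_root m (q : nat -> int) : (0 < m)%N -> (forall i, q i = 1 \/ q i = -1) ->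
    \sum_(i < m) (q i)%:~R * growth_rate c ^+ i = 0 -> exists n (q : nat -> int),
    [/\ (0 < n)%N, forall i, q i = 1 \/ q i = -1 & \sum_(i < n) (q i)%:~R * z ^+ i = 0].
  move=> m0 qpm /intpoly_growth_root/(min_poly_dvdp pmin) dvd.
  exists m, q; split=> //.
  have : root (map_poly ratr (intpoly m q)) z.
    by apply: root_dvdp pz; rewrite dvdp_map.
  by rewrite map_intpoly => /rootP; rewrite horner_poly.
have [c0|c0|c0] := ltgtP c 0.
- pose sgi j : int := if 0 <= iter j (quad c) 0 then 1 else -1.
  pose q i : int := \prod_(k < n.-1 - i) sgi k.+1.
  have qpm i : q i = 1 \/ q i = -1.
    rewrite /q; elim: (n.-1 - i)%N => [|k IH]; first by left; rewrite big_ord0.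
    rewrite big_ord_recr/= /sgi; case: ifP => _; rewrite ?mulr1 ?mulrN1//.
    by case: IH => ->; [right|left; rewrite opprK].
  apply: (pm1_root n q) => //; apply: kneading_int_root => //.
    by rewrite /q subnn big_ord0.
  move=> j jn.
  have -> : q (n.-1 - j)%N * q (n - j)%N = sgi j.
    have E1 : (n.-1 - (n.-1 - j) = j.-1.+1)%N by lia.
    have E2 : (n.-1 - (n - j) = j.-1)%N by lia.
    have := qpm (n - j)%N; rewrite /q E1 E2 big_ord_recr/= mulrAC -expr2.
    by move=> [->|->]; rewrite ?sqrrN expr1n mul1r prednK//; lia.
  rewrite /sgi; case: (leP 0 (iter j (quad c) 0)) => h; first by rewrite rmorph1 mul1r.
  by rewrite rmorphN1 mulN1r oppr_ge0 ltW.
- have : forall k, 0 < iter k.+1 (quad c) 0.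
    by elim=> [|k IH] /=; rewrite /quad ltr_wpDl// sqr_ge0.
  by case: n n0 fn => // k _ fk /(_ k); rewrite fk ltxx.
- apply: (pm1_root 2 (fun i => if i == 0%N then 1 else -1)) => //.
    by move=> i; case: eqP => _; [left|right].
  rewrite c0 growth_rate0 !big_ord_recl big_ord0/= !expr1n !mulr1 addr0.
  by rewrite rmorphN rmorph1 subrr.
Qed.

End SpectralPoly.

(** * Limits of zeros of power series *)

Section ZeroSets.
Variable R : realType.
Local Notation C := R[i].
Implicit Types (z : C) (eps : nat -> C) (e : nat -> int).

Lemma real_of_ge0 (x : C) : 0 <= x -> exists2 r : R, 0 <= r & x = r%:C.
Proof.
move=> x0; have /complex_realP[r xr] := ger0_real x0; exists r => //.
by rewrite -lecR -xr.
Qed.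

Lemma partial_sum_tail eps z N M : (forall k, `|eps k| <= 1) -> `|z| < 1 -> (N <= M)%N ->
  `|\sum_(k < M) eps k * z ^+ k - \sum_(k < N) eps k * z ^+ k| <= `|z| ^+ N / (1 - `|z|).
Proof.
move=> eps1 z1 NM; rewrite -(subnKC NM) big_split_ord/= addrAC subrr add0r.
apply: le_trans (ler_norm_sum _ _ _) _.
apply: (@le_trans _ _ (\sum_(i < M - N) `|z| ^+ N * `|z| ^+ i)).
  apply: ler_sum => i _; rewrite normrM normrX exprD -[leRHS]mul1r.
  by apply: ler_wpM2r => //; rewrite mulr_ge0// exprn_ge0.
rewrite -mulr_sumr; apply: ler_wpM2l; first by rewrite exprn_ge0.
by apply: geometric_sum_le; rewrite normr_ge0.
Qed.

Lemma geometric_bound_cvg0 (u : nat -> C) (B r : R) : 0 <= r < 1 ->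
  (forall N, `|u N| <= (B * r ^+ N)%:C) -> (u : nat -> C^o) @ \oo --> (0 : C^o).
Proof.
move=> /andP[r0 r1] uB; apply/cvgrPdist_lt => e e0.
have [e' e'0 eE] := real_of_ge0 (ltW e0).
have e'_gt0 : 0 < e' by rewrite -ltcR -eE.
have : (fun N => B * r ^+ N) @ \oo --> B * 0.
  by apply: cvgMl_tmp; apply: cvg_expr; rewrite ger0_norm.
rewrite mulr0 => /cvgrPdist_lt/(_ e' e'_gt0); apply: filterS => N.
rewrite !sub0r !normrN => h; apply: le_lt_trans (uB N) _.
by rewrite eE ltcR (le_lt_trans (ler_norm _)).
Qed.

(** Compare with later partial sums, which are arbitrarily small. *)
Lemma pm1_zero_bound eps z : (forall k, eps k = 1 \/ eps k = -1) -> `|z| < 1 ->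
  series (fun k => eps k * z ^+ k : C^o) @ \oo --> (0 : C^o) ->
  forall N, `|\sum_(k < N) eps k * z ^+ k| <= `|z| ^+ N / (1 - `|z|).
Proof.
move=> eps1 z1 /cvgrPdist_lt s0 N; apply/ler_addgt0Pr => e e0.
have [M _ MP] := s0 e e0.
have := MP (maxn M N) (leq_maxl _ _); rewrite seriesEord/= sub0r normrN => h.
have eps1' k : `|eps k| <= 1 by case: (eps1 k) => ->; rewrite ?normrN normr1.
have := partial_sum_tail eps1' z1 (leq_maxr M N).
set SM := \sum_(k < maxn M N) _ in h *; set SN := \sum_(k < N) _ => t.
rewrite -[SN](subrK SM); apply: le_trans (ler_normD _ _) _.
by apply: lerD (ltW h); rewrite distrC.
Qed.

(** The partial sums vanish at the multiples of n. *)
Lemma periodic_zero_bound n e z : (0 < n)%N -> (forall k, e k = 1 \/ e k = -1) ->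
  `|z| < 1 -> \sum_(i < n) (e i)%:~R * z ^+ i = 0 ->
  forall N, `|\sum_(k < N) (e (k %% n)%N)%:~R * z ^+ k| <= `|z| ^+ N / (1 - `|z|).
Proof.
move=> n0 e1 z1 ez N.
have z0 a : \sum_(k < a * n) (e (k %% n)%N)%:~R * z ^+ k = 0.
  elim: a => [|a IH]; first by rewrite big_ord0.
  transitivity (z ^+ (a * n) * \sum_(i < n) (e i)%:~R * z ^+ i); last by rewrite ez mulr0.
  rewrite mulSnr big_split_ord/= IH add0r mulr_sumr; apply: eq_bigr => i _.
  by rewrite modnMDl modn_small// exprD mulrCA.
have Nn : (N <= N * n)%N by rewrite leq_pmulr.
have := @partial_sum_tail (fun k => (e (k %% n)%N)%:~R) z N (N * n) _ z1 Nn.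
rewrite z0 sub0r normrN; apply => k.
by case: (e1 (k %% n)%N) => ->; rewrite ?rmorphN ?normrN normr1.
Qed.

Lemma norm_exprB_le z z' k : `|z| <= 1 -> `|z'| <= 1 ->
  `|z ^+ k - z' ^+ k| <= k%:R * `|z - z'|.
Proof.
move=> z1 z'1; elim: k => [|k IH]; first by rewrite !expr0 subrr normr0 mul0r.
have -> : z ^+ k.+1 - z' ^+ k.+1 = z * (z ^+ k - z' ^+ k) + (z - z') * z' ^+ k.
  by rewrite !exprS; ring.
apply: le_trans (ler_normD _ _) _; rewrite -natr1 [leRHS]mulrDl mul1r !normrM; apply: lerD.
  by rewrite -[leRHS]mul1r; apply: ler_pM.
by rewrite -[leRHS]mulr1; apply: ler_wpM2l => //; rewrite normrX exprn_ile1.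
Qed.

(** Choose for every conjugate z' in the disk a sign sequence E z', and take the limit
    e of these sequences along an ultrafilter that converges to z. For each N there
    are then z' arbitrarily close to z with e and E z' equal up to N. The partial sums
    at z' are bounded uniformly on a disk of radius rho < 1, so those at z tend to 0. *)
Lemma Sigma_disk_sub z : Sigma R z -> `|z| < 1 -> Sigma_pm1 R z.
Proof.
move=> zS z1; split=> //.
pose A := \bigcup_(c in superattracting R) Gal (growth_rate c)%:C : set C^o.
have [r r0 zr] := real_of_ge0 (normr_ge0 z).
have r1 : r < 1 by rewrite -ltcR -zr.
have AE z' : exists e : nat -> int, A z' -> `|z'| < 1 ->
    (forall k, e k = 1 \/ e k = -1) /\
    forall N, `|\sum_(k < N) (e k)%:~R * z' ^+ k| <= `|z'| ^+ N / (1 - `|z'|).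
  have [[Az' z'1]|nA] := pselect (A z' /\ `|z'| < 1); last first.
    by exists (fun=> 1) => Az' z'1; exfalso; apply: nA.
  have [c sc gz] := Az'.
  have [n [q [n0 q1 qz]]] := gal_growth_pm1 sc gz z'1.
  exists (fun k => q (k %% n)%N) => _ _; split; first by move=> k; exact: q1.
  exact: periodic_zero_bound.
have [E EP] := choice AE.
have FP : ProperFilter (within A (nbhs (z : C^o))).
  exact: (@within_nbhs_proper C^o A z zS).
have [G [GU FG]] := ultraFilterLemma FP.
have GA : G A by apply: FG; exact: withinT.
have Gball (d : R) : 0 < d -> G [set z' | `|z - z'| < d%:C].
  move=> d0; apply: FG.
  have nb : nbhs (z : C^o) [set z' | `|z - z'| < d%:C].
    by apply/nbhs_ballP; exists d%:C => //=; rewrite ltcR.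
  by rewrite /within/=; apply: filterS nb.
(* The limit of the sequences E z' along G. *)
pose e k : int := if `[< G [set z' | E z' k = 1] >] then 1 else -1.
have e1 k : e k = 1 \/ e k = -1 by rewrite /e; case: asboolP; [left|right].
have Gdisk : G [set z' | `|z'| < 1].
  apply: filterS (Gball (1 - r) _) => [z' /= h|]; last lra.
  rewrite -[z'](subrK z) (le_lt_trans (ler_normD _ _))// distrC zr.
  by rewrite -ltrBrDr (lt_le_trans h)// rmorphB rmorph1.
have Ge k : G [set z' | E z' k = e k].
  rewrite /e; case: asboolP => // nG.
  have [//|GC] := in_ultra_setVsetC [set z' | E z' k = 1] GU.
  apply: filterS (filterI GC (filterI GA Gdisk)) => z' [/= nE [Az' z'1]].
  by have [/(_ k)[]] := EP z' Az' z'1.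
have GeN N : G [set z' | forall k, (k < N)%N -> E z' k = e k].
  elim: N => [|N IH]; first by apply: filterE.
  apply: filterS (filterI IH (Ge N)) => z' [/= h1 h2] k.
  by rewrite ltnS leq_eqVlt => /predU1P[->|/h1].
exists (fun k => (e k)%:~R).
  by move=> k; case: (e1 k) => ->; [left|right].
rewrite seriesEord; pose rho := (1 + r) / 2.
apply: (@geometric_bound_cvg0 _ ((1 - rho)^-1 + 1) rho); first by rewrite /rho; lra.
move=> N /=.
have rho0 : 0 < rho by rewrite /rho; lra.
have rho1 : rho < 1 by rewrite /rho; lra.
(* Replacing z by z' changes the N-th partial sum by at most N ^ 2 times the distance. *)
pose d := Num.min ((1 - r) / 2) (rho ^+ N / (N ^ 2).+1%:R).
have d0 : 0 < d.
  by rewrite lt_min; apply/andP; split; [lra|rewrite divr_gt0 ?exprn_gt0].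
have [z' [[zz' Az'] Ez']] := filter_ex (filterI (filterI (Gball d d0) GA) (GeN N)).
rewrite /= in zz' Ez'.
have z'rho : `|z'| <= rho%:C.
  rewrite -[z'](subrK z) (le_trans (ler_normD _ _))// distrC zr.
  apply: le_trans (lerD (ltW zz') (lexx _)) _; rewrite -rmorphD lecR.
  have : d <= (1 - r) / 2 by rewrite ge_min lexx.
  by rewrite /rho; lra.
have z'1 : `|z'| < 1 by rewrite (le_lt_trans z'rho)// ltcR.
have [_ /(_ N) Sz'] := EP z' Az' z'1.
have -> : \sum_(k < N) (e k)%:~R * z ^+ k = \sum_(k < N) (E z' k)%:~R * z' ^+ k +
   \sum_(k < N) (e k)%:~R * (z ^+ k - z' ^+ k).
  rewrite -big_split/=; apply: eq_bigr => k _; rewrite Ez'//; ring.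
apply: le_trans (ler_normD _ _) _.
have h1 : `|\sum_(k < N) (E z' k)%:~R * z' ^+ k| <= (rho ^+ N / (1 - rho))%:C.
  apply: le_trans Sz' _.
  have [r' r'0 z'r] := real_of_ge0 (normr_ge0 z').
  have r'rho : r' <= rho by rewrite -lecR -z'r.
  have -> : `|z'| ^+ N / (1 - `|z'|) = (r' ^+ N / (1 - r'))%:C.
    by rewrite z'r rmorphM fmorphV rmorphB rmorphXn rmorph1.
  rewrite lecR; apply: ler_pM; rewrite ?exprn_ge0 ?invr_ge0//; first lra.
    by apply: lerXn2r; rewrite ?nnegrE// ltW.
  by rewrite lef_pV2 ?posrE; lra.
have h2 : `|\sum_(k < N) (e k)%:~R * (z ^+ k - z' ^+ k)| <= (rho ^+ N)%:C.
  apply: le_trans (ler_norm_sum _ _ _) _.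
  apply: (@le_trans _ _ (\sum_(k < N) N%:R * d%:C)).
    apply: ler_sum => k _; rewrite normrM.
    have -> : `|(e k)%:~R : C| = 1.
      by case: (e1 k) => ->; rewrite ?rmorphN ?normrN normr1.
    rewrite mul1r; apply: le_trans (norm_exprB_le k (ltW z1) (ltW z'1)) _.
    apply: ler_pM => //; last exact: ltW.
    by rewrite ler_nat ltnW.
  rewrite sumr_const card_ord -[leLHS]mulr_natl -(rmorph_nat (real_complex R)).
  rewrite -!rmorphM lecR mulrA -natrM.
  have dN : d <= rho ^+ N / (N ^ 2).+1%:R by rewrite ge_min lexx orbT.
  apply: le_trans (ler_wpM2l (ler0n _ _) dN) _.
  rewrite mulrCA -[leRHS]mulr1; apply: ler_wpM2l; first by rewrite exprn_ge0 ?ltW.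
  by rewrite ler_pdivrMr// mul1r ler_nat mulnn leqnSn.
apply: le_trans (lerD h1 h2) _.
by rewrite -rmorphD lecR mulrDl mul1r mulrC.
Qed.

End ZeroSets.

(** * Approximating zeros by conjugates of growth rates *)

Section Approximation.
Variable R : realType.
Local Notation C := R[i].

Lemma bernoulli_le (x : R) k : 0 <= x <= 1 -> 1 - k%:R * x <= (1 - x) ^+ k.
Proof.
move=> /andP[x0 x1]; elim: k => [|k IH]; first by rewrite mul0r subr0 expr0.
rewrite exprSr -natr1.
have h : (1 - k%:R * x) * (1 - x) <= (1 - x) ^+ k * (1 - x).
  by apply: ler_wpM2r => //; lra.
apply: le_trans h; have := ler0n R k; move: (k%:R : R) => t t0; nra.
Qed.

(** Write q <= t ^+ K.+1 with t < 1: the product m^K q^m is at most m^-1 times the power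
    of order K.+1 of m t^m, which is bounded. *)
Lemma poly_exp_small (q B : R) K : 0 <= q < 1 -> 0 <= B ->
  exists m0, forall m, (m0 <= m)%N -> B * (m%:R ^+ K * q ^+ m) <= 2^-1.
Proof.
move=> /andP[q0 q1] B0.
pose x := (1 - q) / K.+1%:R; pose t := 1 - x.
have K0 : 0 < K.+1%:R :> R by rewrite ltr0n.
have x0 : 0 < x by rewrite divr_gt0 ?subr_gt0.
have x1 : x <= 1.
  rewrite ler_pdivrMr// mul1r (@le_trans _ _ 1)//; first by lra.
  by rewrite ler1n.
have qt : q <= t ^+ K.+1.
  apply: le_trans (bernoulli_le K.+1 (_ : 0 <= x <= 1)); last by rewrite ltW.
  by rewrite mulrC divfK ?gt_eqF//; lra.
have t01 : 0 <= t < 1 by rewrite /t; apply/andP; split; lra.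
have D m : m%:R ^+ K.+1 * q ^+ m <= (1 - t)^-1 ^+ K.+1.
  apply: (@le_trans _ _ ((m%:R * t ^+ m) ^+ K.+1)).
    rewrite exprMn; apply: ler_wpM2l; first by rewrite exprn_ge0.
    by rewrite exprAC; apply: lerXn2r; rewrite ?nnegrE ?exprn_ge0//; case/andP: t01.
  apply: lerXn2r; rewrite ?nnegrE ?mulr_ge0 ?exprn_ge0 ?invr_ge0//; try lra.
  exact: mulrn_exp_le.
set E := _ ^+ K.+1 in D.
have E0 : 0 <= E by rewrite exprn_ge0// invr_ge0; lra.
have BE0 : 0 <= 2 * (B * E) by rewrite !mulr_ge0.
exists (Num.bound (2 * (B * E))).+1 => m mb.
have m0 : 0 < m%:R :> R by rewrite ltr0n (leq_trans _ mb).
have mBE : 2 * (B * E) <= m%:R.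
  by apply: le_trans (ltW (archi_boundP BE0)) _; rewrite ler_nat ltnW.
have := ler_wpM2l B0 (D m); rewrite exprS -mulrA mulrCA.
move: (B * (_ * _)) => y my.
have y2 : y * (2 * m%:R) <= 1 * m%:R by move: my mBE; lra.
by rewrite -div1r ler_pdivlMr// -(ler_pM2r m0) -mulrA.
Qed.

(** The prescribed low-order coefficients, one free sign tau, and a top part that spells
    the long initial run of the kneading sequence. *)
Definition target_coef (e : nat -> int) (tau : int) (h i : nat) : int :=
  if (i < h.-2)%N then e i else if i == h.-2 then tau
  else if (i < h.*2.-1)%N then -1 else 1.

Lemma target_parameter (e : nat -> int) (tau : int) (h : nat) :
  (2 < h)%N -> (forall i, e i = 1 \/ e i = -1) -> (tau = 1 \/ tau = -1) ->
  exists2 c : R, superattracting R c &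
    \sum_(i < h.*2) (target_coef e tau h i)%:~R * growth_rate c ^+ i = 0.
Proof.
move=> h2 e1 tau1; set q := target_coef e tau h.
have qpm i : q i = 1 \/ q i = -1.
  by rewrite /q /target_coef; do ![case: ifP => _ //]; [right|left].
have qtop : q h.*2.-1 = 1.
  rewrite /q /target_coef ltnn; case: ltnP => [|_]; first lia.
  by case: eqP => //; lia.
have qrun i : (h.-1 <= i <= h.*2 - 2)%N -> q i = -1.
  move=> hi; rewrite /q /target_coef; case: ltnP => [|_]; first lia.
  case: eqP => [|_]; first lia.
  by case: ltnP => //; lia.
pose sg (j : nat) : R := (q (h.*2.-1 - j)%N * q (h.*2 - j)%N)%:~R.
have sg_pm j : sg j = 1 \/ sg j = -1.
  rewrite /sg; case: (qpm (h.*2.-1 - j)%N) => ->; case: (qpm (h.*2 - j)%N) => ->;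
  rewrite ?mulr1 ?mulrNN ?mulN1r ?mulr1; by [left|right].
have [| | | |c [cI fc sc]] := @realization R h.*2 h sg (fun j _ => sg_pm j).
- rewrite /sg (_ : h.*2 - 1 = h.*2.-1)%N; last lia.
  by rewrite qtop qrun ?mulr1 ?rmorphN1//; lia.
- move=> j jh; rewrite /sg !qrun; [by rewrite mulrNN mulr1|lia|lia].
- lia.
- by [].
exists c.
  split; first by move: cI => /andP[? ?]; apply/andP; split => //; lra.
  by exists h.*2 => //; lia.
by apply: kneading_int_root => //; [lra|lra|lia].
Qed.

(** The lemma near_root applies once h is large: with m = h.-2 prescribed coefficients, the value
    at z is O(|z|^m), and the degree is at most 4 m. *)
Lemma pm1_zero_approx (eps : nat -> C) (z : C) (d : R) :
  (forall k, eps k = 1 \/ eps k = -1) -> `|z| < 1 ->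
  series (fun k => eps k * z ^+ k : C^o) @ \oo --> (0 : C^o) -> 0 < d <= 1 ->
  exists2 c, superattracting R c & exists2 w, Gal (growth_rate c)%:C w & `|z - w| < d%:C.
Proof.
move=> eps1 z1 s0 /andP[d0 d1].
have [r r0 zr] := real_of_ge0 (normr_ge0 z).
have r1 : r < 1 by rewrite -ltcR -zr.
have [rho rrho rho1] : exists2 rho : R, r < rho & rho < 1.
  by exists ((1 + r) / 2); lra.
have rho0 : 0 < rho by exact: le_lt_trans rrho.
have th01 : 0 <= r / rho < 1 by rewrite divr_ge0 ?(ltW rho0)//= ltr_pdivrMr// mul1r.
pose B0 := 2 / (1 - rho ^+ 2) + 2.
have rho21 : rho ^+ 2 < 1 by rewrite exprn_ilt1// ltW.
have B00 : 0 <= B0 by rewrite addr_ge0// divr_ge0// subr_ge0 ltW.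
have [K KP] : exists K, (r / rho) ^+ (K * 2) * B0 < 4^-1.
  have B04 : 0 <= 4 * B0 by rewrite mulr_ge0.
  have [K /(_ (K * 2)%N)] := poly_exp_small 0 th01 B04.
  rewrite leq_pmulr// => /(_ isT); rewrite expr0 mul1r => h; exists K.
  by move: h; move: (_ ^+ _) => y; lra.
pose E0 : R := K.+1%:R * (K%:R * (2 / (1 - r) * (4 / d) ^+ K * 2 ^+ K)).
have E00 : 0 <= E0.
  have h1 : 0 <= 2 / (1 - r) by rewrite divr_ge0 ?subr_ge0// ltW.
  have h2 : 0 <= 4 / d by rewrite divr_ge0 // ltW.
  by rewrite /E0; do !apply: mulr_ge0 => //; rewrite exprn_ge0.
have r01 : 0 <= r < 1 by rewrite r0.
have [m0 m0P] := poly_exp_small K r01 E00.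
have [j jE] : exists j, j = m0.+4 by exists m0.+4.
have [h hE] : exists h, h = (2 ^ j)%N by exists (2 ^ j)%N.
have hj : (j < h)%N by rewrite hE ltn_expl.
have [m hm] : exists m, h = m.+2.
  by exists h.-2; rewrite -subn2 -addn2 subnK// (leq_trans _ hj)// jE.
have m0m : (m0 <= m)%N by move: hj; rewrite jE hm; clear; lia.
have hm2 : h.-2 = m by rewrite hm.
pose e k : int := if eps k == 1 then 1 else -1.
have eE k : (e k)%:~R = eps k :> C.
  rewrite /e; case: eqP => [->|] //.
  by case: (eps1 k) => -> // _; rewrite rmorphN1.
have e1 k : e k = 1 \/ e k = -1 by rewrite /e; case: eqP; [left|right].
(* Changing tau changes the sum by 2. *)
have [tau tau1 tau4] : exists2 tau : int, tau = 1 \/ tau = -1 &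
    ~~ (4 %| \sum_(i < h.*2) target_coef e tau h i)%Z.
  have split_tau tau : \sum_(i < h.*2) target_coef e tau h i =
      tau + \sum_(i < h.*2 | i != m :> nat) target_coef e 1 h i.
    have mh : (m < h.*2)%N by rewrite hm; clear; lia.
    rewrite (bigD1 (Ordinal mh))//=; congr (_ + _).
      by rewrite /target_coef hm2 ltnn eqxx.
    apply: eq_big => [i|i]; first by rewrite -val_eqE.
    by rewrite -val_eqE/= => /negbTE im; rewrite /target_coef hm2 im.
  have [h4|h4] := boolP (4 %| \sum_(i < h.*2) target_coef e 1 h i)%Z; last first.
    by exists 1 => //; left.
  exists (-1); first by right.
  move: h4; rewrite !split_tau; move: (\sum_(i < _ | _) _) => S; clear; lia.
have h2 : (2 < h)%N by rewrite (leq_trans _ hj)// jE.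
have [c sc qroot] := target_parameter h2 e1 tau1.
exists c => //.
set q := target_coef e tau h in tau4 qroot.
have qpm i : q i = 1 \/ q i = -1.
  by rewrite /q /target_coef; do ![case: ifP => _ //]; [right|left].
have [n nh] : exists n, n = h.*2 by exists h.*2.
rewrite -nh in tau4 qroot.
have nE : n = (2 ^ j.+1)%N by rewrite nh hE -mul2n expnS.
have nm : n = m.*2.+4 by rewrite nh hm.
have n0 : (0 < n)%N by rewrite nm.
have irr : irreducible_poly (intpoly n q).
  by rewrite /intpoly nE; apply: pm1_irreducible => //; rewrite -nE.
have q_neq0 i : (q i)%:~R != 0 :> C by case: (qpm i) => ->; rewrite ?rmorphN1 ?oppr_eq0 oner_eq0.
have minp : is_min_poly (intpoly n q) (growth_rate c)%:C.
  apply: irreducible_min_poly => //; last exact: intpoly_growth_root.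
  rewrite monicE lead_coef_map_inj//; last exact: intr_inj.
  rewrite lead_coef_poly//.
    rewrite /q /target_coef -nh ltnn hm2 nm; case: ltnP => [|_]; first by clear; lia.
    by case: (m.*2.+4.-1 =P m) => // E; exfalso; move: E; clear; lia.
  by case: (qpm n.-1) => ->.
pose Q : {poly C} := \poly_(i < n) (q i)%:~R.
have sQ : size Q = n by rewrite size_poly_eq.
have Q0 : Q != 0 by rewrite -size_poly_gt0 sQ.
have norm_int i : `|(q i)%:~R : C| = 1.
  by case: (qpm i) => ->; rewrite ?rmorphN1 ?normrN normr1.
have [||||||w Qw wz] := @near_root C Q z rho%:C d%:C K.
- by rewrite -(rmorph0 (real_complex R)) -(rmorph1 (real_complex R)) ltcR lecR d0.
- by rewrite zr -(rmorph1 (real_complex R)) !ltcR rrho.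
- exact: Q0.
- by move=> i; rewrite sQ coef_poly => ->.
- rewrite zr; have -> : (r%:C / rho%:C) ^+ (K * 2) * (2 / (1 - rho%:C ^+ 2) + 2) =
      ((r / rho) ^+ (K * 2) * B0)%:C.
    rewrite rmorphM rmorphXn rmorphM fmorphV /B0 rmorphD rmorphM fmorphV.
    by rewrite rmorphB rmorphXn rmorph1 rmorph_nat.
  by rewrite -(rmorph_nat (real_complex R)) -fmorphV ltcR.
- rewrite sQ.
  have Qz : `|Q.[z]| <= (2 / (1 - r) * r ^+ m)%:C.
    have mn : (m <= n)%N by rewrite nm; clear; lia.
    pose q' k : C := (q k)%:~R.
    have q'1 k : `|q' k| <= 1 by rewrite norm_int.
    have := partial_sum_tail q'1 z1 mn.
    have := pm1_zero_bound eps1 z1 s0 m.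
    have -> : \sum_(k < m) eps k * z ^+ k = \sum_(k < m) q' k * z ^+ k.
      by apply: eq_bigr => k _; rewrite /q' /q /target_coef hm2 ltn_ord eE.
    rewrite /Q horner_poly -[X in `|X| <= (2 / _ * _)%:C](subrK (\sum_(k < m) q' k * z ^+ k)).
    move: (\sum_(k < m) _) (\sum_(k < n) _) => S1 S2 h1 h2'.
    apply: le_trans (ler_normD _ _) _; apply: le_trans (lerD h2' h1) _.
    have -> : `|z| ^+ m / (1 - `|z|) = (r ^+ m / (1 - r))%:C.
      by rewrite zr rmorphM fmorphV rmorphB rmorphXn rmorph1.
    rewrite -rmorphD lecR le_eqVlt; apply/orP; left; apply/eqP.
    by move: (r ^+ m) (1 - r)^-1 => x y; ring.
  have dC : 0 < d%:C by rewrite -(rmorph0 (real_complex R)) ltcR.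
  have m3 : (2 < m)%N by move: hj; rewrite jE hm; clear; lia.
  have nd : n%:R / d%:C <= (m%:R * (4 / d))%:C.
    rewrite -(rmorph_nat (real_complex R)) -fmorphV -rmorphM lecR mulrA.
    apply: ler_wpM2r; first by rewrite invr_ge0 ltW.
    by rewrite -natrM ler_nat nm; move: m3; clear; lia.
  apply: (@le_trans _ _ (K.+1%:R * (K%:R * ((2 / (1 - r) * r ^+ m)%:C *
      (m%:R * (4 / d))%:C ^+ K * 2 ^+ K)))).
    do 2 (apply: ler_wpM2l; first exact: ler0n).
    apply: ler_wpM2r; first by rewrite exprn_ge0.
    apply: ler_pM => //; first by rewrite exprn_ge0// divr_ge0// ltW.
    by apply: lerXn2r => //; rewrite nnegrE ?(le_trans _ nd)// divr_ge0// ltW.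
  have := m0P m m0m; rewrite -lecR fmorphV rmorph_nat; apply: le_trans.
  rewrite le_eqVlt; apply/orP; left; apply/eqP.
  have t2 : 2 ^+ K = (2 ^+ K : R)%:C by rewrite rmorphXn rmorph_nat.
  rewrite t2 -(rmorph_nat (real_complex R) K) -(rmorph_nat (real_complex R) K.+1).
  rewrite -rmorphXn -!rmorphM; congr (_%:C).
  rewrite /E0 [(m%:R * _) ^+ K]exprMn.
  move: ((4 / d) ^+ K) (m%:R ^+ K) (r ^+ m) (1 - r)^-1 (2 ^+ K) => a1 a2 a3 a4 a5.
  by ring.
exists w => //; exists (intpoly n q) => //; by rewrite map_intpoly.
Qed.

End Approximation.

Theorem proposition5p2 (R : realType) :
  Sigma R `&` unit_disk R = Sigma_pm1 R `&` unit_disk R.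
Proof.
apply/seteqP; split=> z [zS z1]; split=> //; first exact: Sigma_disk_sub.
have [_ [eps eps1 s0]] := zS.
move=> V /nbhs_ballP[d /= d0 dV].
have [d' d'0 dE] := real_of_ge0 (ltW d0).
have d'_gt0 : 0 < d' by rewrite -ltcR -dE.
have dd : 0 < Num.min d' 1 <= 1 by rewrite lt_min d'_gt0 ltr01 ge_min lexx orbT.
have [c sc [w gw wz]] := pm1_zero_approx eps1 z1 s0 dd.
exists w; split; first by exists c.
apply: dV; rewrite /ball/= (lt_le_trans wz)// dE lecR.
by rewrite ge_min lexx.
Qed.
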